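(* Let $m\ge 1$, $q_0=2^m$, $q=2^{2m+1}=2q_0^2$, and let $X_m$ be the Suzuki curve over $\mathbb{F}_q$ (defined in the context). Let $D$ be the divisor on $X_m$ equal to the sum of all $\mathbb{F}_q$-rational points of $X_m$, i.e. $D=P_\infty+\sum_{\alpha,\beta\in\mathbb{F}_q}P_{\alpha,\beta}$, where $P_{\alpha,\beta}$ is the affine point with coordinates $(\alpha,\beta)$. Let $\ell\in\mathbb{N}$ with $\ell\le q^2-1$. Then the set $$S=\left\{\frac{x^a y^b z^c w^d}{(x^q+x)^r} : \begin{array}{l} aq+b(q+q_0)+c(q+2q_0)+d(q+2q_0+1)\le rq^2+\ell,\\ 0\le a\le q-1,\ 0\le b\le 1,\ 0\le c\le q_0-1,\\ 0\le d\le q_0-1,\ 0\le r\le \ell\end{array}\right\}$$ is an $\mathbb{F}_q$-basis of the Riemann–Roch space $\mathcal{L}(\ell D)$.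
   Context: The Suzuki curve $X_m$ is the smooth projective curve over $\mathbb{F}_q$ with affine plane equation $y^q+y=x^{q_0}(x^q+x)$. It has a unique point $P_\infty$ lying over the point at infinity of the plane model; its genus is $g=q_0(q-1)$ and it has exactly $q^2+1$ $\mathbb{F}_q$-rational points (namely $P_\infty$ and the $q^2$ affine points $(\alpha,\beta)$ with $\alpha,\beta\in\mathbb{F}_q$). The functions $x,y$ are the coordinate functions, $z:=x^{2q_0+1}-y^{2q_0}$ and $w:=xy^{2q_0}-z^{2q_0}$; the functions $x,y,z,w$ are regular outside $P_\infty$ with pole orders at $P_\infty$ equal to $q$, $q+q_0$, $q+2q_0$, $q+2q_0+1$ respectively. For a divisor $G$, $\mathcal{L}(G)=\{f: \operatorname{div}(f)+G\ge 0\}\cup\{0\}$. *)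

(* Defs.v *)
From HB Require Import structures.
From mathcomp Require Import all_boot all_order all_algebra.
Set Implicit Arguments. Unset Strict Implicit. Unset Printing Implicit Defensive.
Import Order.TTheory GRing.Theory Num.Theory.
Local Open Scope ring_scope.

(* The function field K of a curve over the finite field F is given as a field
   K together with an embedding iota : F -> K (scalars act through iota). *)

(* Places of K/F, represented by their normalized discrete valuations
   v : K^* -> Z (the value of v at 0 is irrelevant and never used). *)
Definition is_place (F : finFieldType) (K : fieldType)
    (iota : {rmorphism F -> K}) (v : K -> int) : Prop :=
  [/\ (forall a b : K, a != 0 -> b != 0 -> v (a * b) = v a + v b),
      (forall a b : K, a != 0 -> b != 0 -> a + b != 0 ->
          Order.min (v a) (v b) <= v (a + b)),
      (forall c : F, c != 0 -> v (iota c) = 0) &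
      (exists t : K, t != 0 /\ v t = 1)].

(* A place is F-rational (degree one) iff its residue field is F, i.e. every
   element of the valuation ring is congruent to a constant mod the maximal ideal. *)
Definition is_rational_place (F : finFieldType) (K : fieldType)
    (iota : {rmorphism F -> K}) (v : K -> int) : Prop :=
  forall f : K, f != 0 -> 0 <= v f ->
    exists c : F, f - iota c = 0 \/ 0 < v (f - iota c).

Definition RR_lD (F : finFieldType) (K : fieldType)
    (iota : {rmorphism F -> K}) (l : nat) (f : K) : Prop :=
  forall v : K -> int, is_place iota v -> f != 0 ->
    (is_rational_place iota v -> - (l%:Z) <= v f) /\
    (~ is_rational_place iota v -> 0 <= v f).

Definition ev2 (F : finFieldType) (K : fieldType)
    (iota : {rmorphism F -> K}) (x y : K) (p : {poly {poly F}}) : K :=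
  \sum_(i < size p) (map_poly iota p`_i).[x] * y ^+ i.

Definition lin_indep (F : finFieldType) (K : fieldType)
    (iota : {rmorphism F -> K}) (P : K -> Prop) : Prop :=
  forall (s : seq K) (c : K -> F), uniq s -> (forall f, f \in s -> P f) ->
    \sum_(f <- s) iota (c f) * f = 0 -> forall f, f \in s -> c f = 0.

Definition is_basis_of (F : finFieldType) (K : fieldType)
    (iota : {rmorphism F -> K}) (P V : K -> Prop) : Prop :=
  [/\ (forall f, P f -> V f),
      lin_indep iota P &
      (forall f, V f -> exists (s : seq K) (c : K -> F),
          (forall g, g \in s -> P g) /\ f = \sum_(g <- s) iota (c g) * g)].

(* Main.v *)
Require Import Defs.
From HB Require Import structures.
From mathcomp Require Import all_boot all_order all_algebra all_field.
From mathcomp Require Import boolp classical_sets.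
From mathcomp Require Import zify ring.
Import Order.TTheory GRing.Theory Num.Theory.
Local Open Scope ring_scope.

(* Write [t = x^q + x]. At a place with [v x < 0] the equations for [y], [z],
   [w] force the values [-q], [-(q+q0)], [-(q+2q0)], [-(q+2q0+1)] up to a common
   factor. The relations [y^2 = w + xz], [z^q0 = y + x^(q0+1)] and
   [w^q0 = z + x^q0 y] show that the monomials [t^k x^a y^b z^c w^d] with [a < q],
   [b < 2], [c, d < q0] span [F[x,y]]; their values at such a place are distinct,
   which gives linear independence, and shows that the common factor is 1 and
   that the place is rational. At the other rational places [t] is a
   uniformizer, and it is a unit at the remaining ones, so [f] in [L(lD)] gives
   [f t^l] regular at all places with [v x >= 0]. Such a function lies in
   [R = F[x,y]] because that ring is integrally closed: [R = R^2 + x R^2], and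
   [x] is not a square. Expanding [f t^l] in the monomials
   above, the bound [l < q^2] forces [k <= l] in each term.

   Places are obtained from maximal subalgebras avoiding a given element (Zorn),
   which are valuation rings; their value group is discrete because elements of
   [F[x,y]] satisfy monic equations of degree [q] over [F[x]]. *)

Set Implicit Arguments.
Unset Strict Implicit.
Unset Printing Implicit Defensive.

(** * Valuation rings and places *)

Section ValuationRings.
Variables (F : finFieldType) (K : fieldType) (iota : {rmorphism F -> K}).

Definition subalg (A : K -> Prop) : Prop :=
  [/\ forall c, A (iota c), forall a b, A a -> A b -> A (a + b)
    & forall a b, A a -> A b -> A (a * b)].

Section Subalgebra.
Variables (A : K -> Prop) (algA : subalg A).

Lemma subalgC c : A (iota c). Proof. by case: algA. Qed.
Lemma subalgD a b : A a -> A b -> A (a + b). Proof. by case: algA => _ + _; apply. Qed.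
Lemma subalgM a b : A a -> A b -> A (a * b). Proof. by case: algA => _ _; apply. Qed.
Lemma subalg0 : A 0. Proof. by rewrite -(rmorph0 iota); apply: subalgC. Qed.
Lemma subalg1 : A 1. Proof. by rewrite -(rmorph1 iota); apply: subalgC. Qed.
Lemma subalgN a : A a -> A (- a).
Proof.
by move=> Aa; rewrite -mulN1r -(rmorphN1 iota); apply: subalgM => //; apply: subalgC.
Qed.
Lemma subalgB a b : A a -> A b -> A (a - b).
Proof. by move=> Aa Ab; apply: subalgD => //; apply: subalgN. Qed.
Lemma subalgX a n : A a -> A (a ^+ n).
Proof.
by move=> Aa; elim: n => [|n IHn]; rewrite ?expr0 ?exprS; [apply: subalg1 | apply: subalgM].
Qed.
Lemma subalg_sum (I : Type) (r : seq I) (P : pred I) (E : I -> K) :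
  (forall i, P i -> A (E i)) -> A (\sum_(i <- r | P i) E i).
Proof.
move=> AE; elim/big_rec: _ => [|i a Pi Aa]; first exact: subalg0.
by apply: subalgD => //; apply: AE.
Qed.

Definition adjoin (h f : K) : Prop :=
  exists2 p : {poly K}, forall i, A p`_i & f = p.[h].

Lemma adjoin_subalg h : subalg (adjoin h).
Proof.
split=> [c|a b [p Ap ->] [r Ar ->]|a b [p Ap ->] [r Ar ->]].
- exists (iota c)%:P; last by rewrite hornerC.
  by move=> i; rewrite coefC; case: eqP => _; [apply: subalgC | apply: subalg0].
- by exists (p + r); [move=> i; rewrite coefD; apply: subalgD | rewrite hornerD].
- exists (p * r); last by rewrite hornerM.
  by move=> i; rewrite coefM; apply: subalg_sum => j _; apply: subalgM.
Qed.

Lemma sub_adjoin h a : A a -> adjoin h a.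
Proof.
move=> Aa; exists a%:P; last by rewrite hornerC.
by move=> i; rewrite coefC; case: eqP => _ //; apply: subalg0.
Qed.

Lemma mem_adjoin h : adjoin h h.
Proof.
exists 'X; last by rewrite hornerX.
by move=> i; rewrite coefX; case: eqP => _; [apply: subalg1 | apply: subalg0].
Qed.

(* Kaplansky: multiplying the first relation by [1 - r 0] and replacing
   [(1 - r 0) h^n] by means of the second one lowers the degree [n]. *)
Lemma unit_ideal_descent (g h : K) (n m : nat) (p r : nat -> K) :
    g != 0 -> h != 0 -> ~ A g -> A g^-1 ->
    (forall i, A (g * p i)) -> (forall i, A (g * r i)) ->
    \sum_(i < n.+1) p i * h ^+ i = 1 -> \sum_(i < m.+1) r i * h^-1 ^+ i = 1 ->
  False.
Proof.
move=> g0 + nAg Agi; move: h p r.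
have [s] := ubnP (n + m); elim: s n m => // s IHs n m ltnms h p r h0 Ap Ar hp hr.
wlog lemn : n m h p r h0 Ap Ar hp hr ltnms / (m <= n)%N.
  move=> W; case: (leqP m n) => [|/ltnW] le; first exact: (W n m h p r).
  by apply: (W m n h^-1 r p); rewrite ?invr_eq0 ?invrK // addnC.
case: n lemn hp ltnms => [|n] lemn hp ltnms.
  by apply: nAg; move: hp (Ap 0%N); rewrite big_ord1 /= expr0 mulr1 => ->; rewrite mulr1.
pose r' j := if (j <= m)%N then r j else 0.
have Ar' j : A (g * r' j).
  by rewrite /r'; case: ifP => _ //; rewrite mulr0; apply: subalg0.
(* The coefficients lie in [g^-1 A], which is closed under products because [g^-1] belongs to
   [A]. *)
have ApM a b : A (g * a) -> A (g * b) -> A (g * (a * b)).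
  move=> Aa Ab; rewrite (_ : g * _ = g^-1 * ((g * a) * (g * b))).
    by do 2!apply: subalgM => //.
  by rewrite -mulrA mulKf // mulrCA.
pose p' i := (if i == 0%N then r 0%N else 0) + (p i - r 0%N * p i) + p n.+1 * r' (n.+1 - i)%N.
apply: (IHs n m _ h p' r) => //.
  move=> i; rewrite /p' !mulrDr mulrN; apply: subalgD; last exact: ApM.
  apply: subalgD; last by apply: subalgB => //; apply: ApM.
  by case: eqP => _ //; rewrite mulr0; apply: subalg0.
have hr' : \sum_(j < n.+1) r' j.+1 * h^-1 ^+ j.+1 = 1 - r 0%N.
  have <- : \sum_(i < n.+2) r' i * h^-1 ^+ i = 1.
    rewrite -hr (big_ord_widen_cond n.+2 predT (fun i => r i * h^-1 ^+ i)) //=.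
    rewrite [RHS]big_mkcond /=; apply: eq_bigr => i _.
    by rewrite /r' ltnS; case: ifP => _ //; rewrite mul0r.
  by rewrite [in RHS]big_ord_recl /= ?expr0 mulr1 addrC addKr.
have := congr1 (fun s => p n.+1 * h ^+ n.+1 * s) hr'.
rewrite mulr_sumr (reindex_inj rev_ord_inj) /=.
have -> : \sum_(j < n.+1) p n.+1 * h ^+ n.+1 *
    (r' (n.+1 - j.+1).+1 * h^-1 ^+ (n.+1 - j.+1).+1)
    = \sum_(i < n.+1) p n.+1 * r' (n.+1 - i)%N * h ^+ i.
  apply: eq_bigr => i _; rewrite subSS -subSn ?leq_ord // mulrACA; congr (_ * _).
  rewrite exprVn -expfB_cond; last by rewrite (negPf h0) leq_subr.
  by rewrite subKn // ltnW // ltnS leq_ord.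
move=> E; rewrite /p'.
under eq_bigr do rewrite !mulrDl.
rewrite big_split /= E big_split /= big_ord_recl /= ?expr0 mulr1 big1 ?addr0; last first.
  by move=> i _; rewrite mul0r.
have -> : \sum_(i < n.+1) (p i * h ^+ i + - (r 0%N * p i) * h ^+ i)
   = (1 - r 0%N) * (1 - p n.+1 * h ^+ n.+1).
  have -> : 1 - p n.+1 * h ^+ n.+1 = \sum_(i < n.+1) p i * h ^+ i.
    by rewrite -hp big_ord_recr /= addrK.
  by rewrite mulr_sumr; apply: eq_bigr => i _; ring.
by ring.
Qed.

End Subalgebra.

Lemma maximal_subalg (B : K -> Prop) (g : K) : subalg B -> ~ B g ->
  exists A : K -> Prop, [/\ subalg A, forall f, B f -> A f, ~ A g &
    forall A' : K -> Prop, subalg A' -> (forall f, A f -> A' f) -> ~ A' g ->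
      forall f, A' f -> A f].
Proof.
move=> algB nBg.
(* Zorn's lemma also asks for a bound of the empty chain, whose union is empty. Joining [B] to every
   set turns that union into [B] itself. *)
pose U (X : set K) := fun f : K => B f \/ X f.
have [|A [[algA nAg] maxA]] :=
    @Zorn_bigcup K (fun X => subalg (U X) /\ ~ U X g).
- move=> C CP totC; split; last by case=> // -[X CX Xg]; case: (CP X CX) => _ []; right.
  have up X f : C X -> U X f -> U (\bigcup_(X in C) X)%classic f.
    by move=> CX [Bf|Xf]; [left | right; exists X].
  have two a b : U (\bigcup_(X in C) X)%classic a -> U (\bigcup_(X in C) X)%classic b ->
      (B a /\ B b) \/ exists X, [/\ C X, U X a & U X b].
    move=> [Ba|[X CX Xa]] [Bb|[Y CY Yb]]; first by left.
    + by right; exists Y; split=> //; [left | right].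
    + by right; exists X; split=> //; [right | left].
    + right; case: (totC X Y CX CY) => sub.
        by exists Y; split=> //; right => //; apply: sub.
      by exists X; split=> //; right => //; apply: sub.
  split=> [c|a b Ua Ub|a b Ua Ub]; first by left; apply: subalgC.
  + case: (two a b Ua Ub) => [[Ba Bb]|[X [CX Xa Xb]]]; first by left; apply: subalgD.
    by apply: (up X) => //; apply: subalgD => //; case: (CP X CX).
  + case: (two a b Ua Ub) => [[Ba Bb]|[X [CX Xa Xb]]]; first by left; apply: subalgM.
    by apply: (up X) => //; apply: subalgM => //; case: (CP X CX).
exists (U A); split=> // [f Bf|A' algA' subA' nA'g f A'f]; first by left.
have [Af|nAf] := pselect (A f); first by right.
have UA' : U A' = A'.
  apply/funext => k; apply/propext; split; last by right.
  by case=> // Bk; apply: subA'; left.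
case: (maxA A'); last by rewrite UA'.
split; first by move=> k Ak; apply: subA'; right.
by move=> /(_ f A'f).
Qed.

Definition valring (A : K -> Prop) : Prop := subalg A /\ forall h, A h \/ A h^-1.

(** Take [A] maximal among the subalgebras containing [B] and avoiding [g]. If neither [h] nor
    [h^-1] were in [A], then [g] would lie in both [A[h]] and [A[h^-1]]; dividing by [g] writes 1 as
    a polynomial in [h] and in [h^-1] with coefficients in [g^-1 A], which the descent excludes. *)
Lemma exists_valring (B : K -> Prop) (g : K) : subalg B -> ~ B g -> B g^-1 ->
  exists A, [/\ valring A, forall f, B f -> A f & ~ A g].
Proof.
move=> algB nBg Bgi; have [A [algA subA nAg maxA]] := maximal_subalg algB nBg.
exists A; split=> //; split=> // h.
have [Ah|nAh] := pselect (A h); first by left.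
have [Ahi|nAhi] := pselect (A h^-1); first by right.
have [h0|h0] := eqVneq h 0; first by case: nAh; rewrite h0; apply: subalg0.
have g0 : g != 0 by apply/eqP => g0; case: nBg; rewrite g0; apply: subalg0.
have get k : ~ A k -> exists n, exists2 p : nat -> K, forall i, A (g * p i)
    & \sum_(i < n.+1) p i * k ^+ i = 1.
  move=> nAk; have [[p Ap gp]|nadj] := pselect (adjoin A k g); last first.
    case: nAk; apply: (maxA _ (adjoin_subalg algA k) _ nadj); last exact: mem_adjoin.
    by move=> f; apply: sub_adjoin.
  exists (size p), (fun i => g^-1 * p`_i) => [i|]; first by rewrite mulVKf.
  rewrite -(mulVf g0) [X in _ * X]gp (@horner_coef_wide _ (size p).+1) //.
  by rewrite mulr_sumr; apply: eq_bigr => i _; rewrite mulrA.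
have [n [p Ap hp]] := get _ nAh; have [m [r Ar hr]] := get _ nAhi.
by case: (@unit_ideal_descent A algA g h n m p r) => //; apply: subA.
Qed.

End ValuationRings.

(** * From a valuation ring to a normalized discrete valuation *)

Section PlaceOfValuationRing.
Variables (F : finFieldType) (K : fieldType) (iota : {rmorphism F -> K}).
Variables (A : K -> Prop) (valA : valring iota A).

Let algA : subalg iota A. Proof. by case: valA. Qed.
Let A1 : A 1. Proof. exact: (subalg1 algA). Qed.

Definition unitA (u : K) : Prop := [/\ u != 0, A u & A u^-1].

Lemma unitA1 : unitA 1. Proof. by split; rewrite ?oner_eq0 ?invr1. Qed.
Lemma unitAM u v : unitA u -> unitA v -> unitA (u * v).
Proof.
move=> [u0 Au Aui] [v0 Av Avi].
by split; rewrite ?mulf_neq0 ?invfM //; apply: (subalgM algA).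
Qed.
Lemma unitAV u : unitA u -> unitA u^-1.
Proof. by case=> u0 Au Aui; split; rewrite ?invr_eq0 ?invrK. Qed.
Lemma unitAX u n : unitA u -> unitA (u ^+ n).
Proof.
by move=> Au; elim: n => [|n IHn]; rewrite ?expr0 ?exprS; [apply: unitA1 | apply: unitAM].
Qed.
Lemma unitAC c : c != 0 -> unitA (iota c).
Proof.
by move=> c0; split; rewrite ?fmorph_eq0 -?fmorphV //; apply: (subalgC algA).
Qed.

(** The maximal ideal of [A]. Zero is listed apart because [0^-1 = 0] lies in [A]. *)
Definition nonunitA (a : K) : Prop := a = 0 \/ ~ A a^-1.

Lemma nonunitA_sub a : nonunitA a -> A a.
Proof.
case=> [->|nA]; first exact: (subalg0 algA).
by case: (valA.2 a).
Qed.

Lemma nonunitAM a b : A a -> nonunitA b -> nonunitA (a * b).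
Proof.
move=> Aa mb; have [->|a0] := eqVneq a 0; first by left; rewrite mul0r.
case: mb => [->|nAb]; first by left; rewrite mulr0.
right; rewrite invfM => Aab; apply: nAb.
by rewrite -(mulVKf a0 b^-1); apply: (subalgM algA).
Qed.

(** One of [a / b] and [b / a] lies in [A], so the sum is an [A]-multiple of one of the summands. *)
Lemma nonunitAD a b : nonunitA a -> nonunitA b -> nonunitA (a + b).
Proof.
wlog Aab : a b / A (a / b).
  move=> W ma mb; case: (valA.2 (a / b)) => [Aab|]; first exact: W.
  by rewrite invf_div addrC => Aba; apply: W.
move=> ma mb; have [b0|b0] := eqVneq b 0; first by rewrite b0 addr0.
rewrite (_ : a + b = (a / b + 1) * b); last by rewrite mulrDl mul1r divfK.
by apply: nonunitAM => //; apply: (subalgD algA).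
Qed.

Lemma nonunitA_sum (I : Type) (r : seq I) (P : pred I) (E : I -> K) :
  (forall i, P i -> nonunitA (E i)) -> nonunitA (\sum_(i <- r | P i) E i).
Proof.
by move=> mE; elim/big_rec: _ => [|i a Pi ma]; [left | apply: nonunitAD => //; apply: mE].
Qed.

Lemma nonunitA_not_unit u : unitA u -> ~ nonunitA u.
Proof. by move=> [/negPf u0 _ Aui] [/eqP|//]; rewrite u0. Qed.

Lemma unitA_or_max a : A a -> unitA a \/ nonunitA a.
Proof.
move=> Aa; have [->|a0] := eqVneq a 0; first by right; left.
by have [Aai|nAai] := pselect (A a^-1); [left | right; right].
Qed.

Lemma unitAD u a : unitA u -> nonunitA a -> unitA (u + a).
Proof.
move=> uu ma; case: (@unitA_or_max (u + a)) => //.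
  by apply: (subalgD algA); [case: uu | apply: nonunitA_sub].
move=> mua; case: (nonunitA_not_unit uu); rewrite -(addrK a u); apply: nonunitAD => //.
by rewrite -mulN1r; apply: nonunitAM => //; apply: (subalgN algA).
Qed.

Lemma unitA_root h n : (0 < n)%N -> A (h ^+ n) -> A h.
Proof.
case: n => // n _ Ahn; case: (valA.2 h) => // Ahi.
have [->|h0] := eqVneq h 0; first exact: (subalg0 algA).
rewrite -(mulfK (expf_neq0 n h0) h) -exprS -exprVn.
by apply: (subalgM algA) => //; apply: (subalgX algA).
Qed.

(** Divide the relation by a term [E j] of largest size. If no other quotient were a unit, 1 would
    be a sum of elements of the maximal ideal. *)
Lemma sum0_same_value (I : finType) (E : I -> K) (i0 : I) : E i0 != 0 ->
  \sum_i E i = 0 -> exists i j, [/\ i != j, E j != 0 & unitA (E i / E j)].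
Proof.
move=> Ei0 sumE.
have [j [Ej0 maxj]] : exists j, E j != 0 /\ forall i, A (E i / E j).
  have : exists j, E j != 0 /\ forall i, i \in enum I -> A (E i / E j).
    elim: (enum I) => [|i s [j [Ej0 jmax]]]; first by exists i0.
    have [Ei|Ei] := eqVneq (E i) 0.
      exists j; split=> // k; rewrite inE => /orP[/eqP->|/jmax//].
      by rewrite Ei mul0r; apply: (subalg0 algA).
    case: (valA.2 (E i / E j)) => Aij.
      by exists j; split=> // k; rewrite inE => /orP[/eqP->|/jmax].
    exists i; split=> // k; rewrite inE => /orP[/eqP->|/jmax Akj]; first by rewrite divff.
    rewrite (_ : E k / E i = (E k / E j) * (E i / E j)^-1); first exact: (subalgM algA).
    by rewrite invf_div mulrA divfK.
  by case=> j [Ej0 jmax]; exists j; split=> // i; apply: jmax; rewrite mem_enum.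
have [[i [ij u]]|no] := pselect (exists i, i != j /\ unitA (E i / E j)).
  by exists i, j.
case: (nonunitA_not_unit unitA1); have := congr1 (fun a => a / E j) sumE.
rewrite mul0r mulr_suml (bigD1 j) //= divff // => /(canRL (addrK _)).
rewrite sub0r => ->; rewrite -mulN1r; apply: nonunitAM; first exact: (subalgN algA).
apply: nonunitA_sum => i ij; case: (unitA_or_max (maxj i)) => // u.
by case: no; exists i.
Qed.

Variables (tau : K) (N : nat).
Hypotheses (tau0 : tau != 0) (max_tau : nonunitA tau) (N_gt0 : (0 < N)%N).
Hypothesis pow_tau : forall h, h != 0 -> exists k : int, unitA (h ^+ N * tau ^ k).

Lemma tau_exp_ge0 (k : int) : A (tau ^ k) -> 0 <= k.
Proof.
case: k => // n; rewrite NegzE -invr_expz -exprnP => An.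
case: max_tau => [/eqP|nAt]; first by rewrite (negPf tau0).
case: nAt; rewrite -(mulVKf (expf_neq0 n tau0) tau^-1) -invfM -exprSr.
by apply: (subalgM algA) => //; apply: (subalgX algA); apply: nonunitA_sub.
Qed.

(** By [pow_tau] the value group is torsion modulo the powers of [tau]: [W h] is the integer for
    which [h^N] is [tau^(W h)] up to a unit. The values of [W] form a subgroup of the integers
    containing [N], and [v] is [W] divided by the positive generator [e] of this subgroup. *)
Theorem place_of_valring :
  exists2 v : K -> int, is_place iota v & forall h, h != 0 -> (A h <-> 0 <= v h).
Proof.
have /choice[W HW] : forall h, exists k : int, h != 0 -> unitA (h ^+ N * tau ^ (- k)).
  move=> h; have [->|/pow_tau[k hk]] := eqVneq h 0; first by exists 0.
  by exists (- k) => _; rewrite opprK.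
have AW h : h != 0 -> (A h <-> 0 <= W h).
  move=> h0; have [n0 Au Aui] := HW h h0; split=> [Ah|].
    apply: tau_exp_ge0; rewrite -[tau ^ W h](mulVKf (expf_neq0 N h0)).
    apply: (subalgM algA); first exact: (subalgX algA).
    by move: Aui; rewrite invfM -invr_expz invrK.
  case: (W h) Au => // n; rewrite -invr_expz -exprnP => Au _; apply: (unitA_root N_gt0).
  rewrite -(mulfVK (expf_neq0 n tau0) (h ^+ N)); apply: (subalgM algA) => //.
  by apply: (subalgX algA); apply: nonunitA_sub.
have W_uniq h k : h != 0 -> unitA (h ^+ N * tau ^ (- k)) -> W h = k.
  move=> h0 uk.
  have := unitAM (HW h h0) (unitAV uk); rewrite invfM invr_expz opprK mulrACA.
  rewrite divff ?expf_neq0 // mul1r -expfzDr // => -[_ Ak].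
  rewrite invr_expz opprD opprK => Aki.
  have := tau_exp_ge0 Ak; have := tau_exp_ge0 Aki.
  by lia.
have WM a b : a != 0 -> b != 0 -> W (a * b) = W a + W b.
  move=> a0 b0; apply: W_uniq; first exact: mulf_neq0.
  rewrite exprMn opprD expfzDr // mulrACA.
  by apply: unitAM; apply: HW.
have W1 : W 1 = 0.
  by apply: W_uniq; rewrite ?oner_eq0 // expr1n oppr0 expr0z mulr1; apply: unitA1.
have WV a : a != 0 -> W a^-1 = - W a.
  by move=> a0; have := WM a a^-1 a0; rewrite invr_eq0 divff // W1 => /(_ a0); lia.
have WX a n : a != 0 -> W (a ^+ n) = W a * n%:Z.
  move=> a0; elim: n => [|n IHn]; first by rewrite expr0 W1 mulr0.
  by rewrite exprS WM ?expf_neq0 // IHn; lia.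
have Wtau : W tau = N%:Z.
  apply: W_uniq => //; rewrite -invr_expz -exprnP divff ?expf_neq0 //; exact: unitA1.
pose P := [pred n : nat | (0 < n)%N && `[< exists2 h, h != 0 & W h = n%:Z >]].
have exP : exists n, P n.
  by exists N; rewrite /= N_gt0; apply/asboolP; exists tau.
case: (ex_minnP exP) => e /andP[e_gt0 /asboolP[g g0 Wg]] emin.
(* The remainder of [W h] modulo [e] is again a value, taken at [h] times a power of [g]; minimality
   of [e] makes it zero. *)
have dvdW h : h != 0 -> exists k : int, W h = e%:Z * k.
  move=> h0; exists (W h %/ e)%Z; rewrite mulrC.
  have := divz_eq (W h) e; set k := (W h %/ e)%Z; set r := (W h %% e)%Z => Wh.
  have r_ge0 : 0 <= r by apply: modz_ge0; lia.
  have r_lt : r < e by apply: ltz_pmod; lia.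
  have [r0|r0] := eqVneq r 0; first by lia.
  have gk0 : g ^+ `|k|%N != 0 by rewrite expf_neq0.
  have [h' h'0 Wh'] : exists2 h', h' != 0 & W h' = r.
    case: (leP 0 k) => k0.
      exists (h / g ^+ `|k|%N); first by rewrite mulf_neq0 ?invr_eq0.
      by rewrite WM ?invr_eq0 // WV // WX //; nia.
    exists (h * g ^+ `|k|%N); first by rewrite mulf_neq0.
    by rewrite WM // WX //; nia.
  have : P `|r|%N.
    by apply/andP; split; [lia | apply/asboolP; exists h' => //; lia].
  by move/emin; lia.
have /choice[v Hv] : forall h, exists k : int, h != 0 -> W h = e%:Z * k.
  by move=> h; have [->|/dvdW[k]] := eqVneq h 0; [exists 0 | exists k].
have vge0 h : h != 0 -> (0 <= v h) = (0 <= W h) by move=> h0; rewrite Hv //; nia.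
have vM a b : a != 0 -> b != 0 -> v (a * b) = v a + v b.
  move=> a0 b0; have := WM a b a0 b0; rewrite !Hv ?mulf_neq0 //; nia.
exists v; last by move=> h h0; rewrite vge0 //; apply: AW.
split=> //.
- move=> a b a0 b0 ab0.
  wlog le_ab : a b a0 b0 ab0 / v a <= v b.
    move=> Wl; case: (leP (v a) (v b)) => [le|/ltW le].
      by have := Wl _ _ a0 b0 ab0 le; rewrite min_l.
    by rewrite addrC in ab0 *; have := Wl _ _ b0 a0 ab0 le; rewrite min_l.
  rewrite min_l //; have ba0 : b / a != 0 by rewrite mulf_neq0 ?invr_eq0.
  have vV : v a^-1 = - v a.
    by have := WV a a0; rewrite !Hv ?invr_eq0 //; nia.
  have Aba : A (b / a).
    by apply/(AW _ ba0); rewrite -vge0 // vM ?invr_eq0 // vV; lia.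
  have n0 : 1 + b / a != 0.
    by apply: contraNneq ab0 => E; rewrite -(divfK a0 b) -{1}(mul1r a) -mulrDl E mul0r.
  have : 0 <= v (1 + b / a) by rewrite vge0 //; apply/(AW _ n0); apply: (subalgD algA).
  have -> : a + b = a * (1 + b / a) by rewrite mulrDr mulr1 mulrC divfK.
  by rewrite vM //; lia.
- move=> c c0; have [i0 Ac Aci] := unitAC c0.
  have := (AW _ i0).1 Ac; have i0' : (iota c)^-1 != 0 by rewrite invr_eq0.
  have := (AW _ i0').1 Aci; rewrite WV // => w1 w2; have W0 : W (iota c) = 0 by lia.
  by move: W0 (Hv _ i0) => ->; nia.
- by exists g; split=> //; have := Hv _ g0; rewrite Wg; nia.
Qed.

End PlaceOfValuationRing.

(** * Arithmetic of values at a place *)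

Section Places.
Variables (F : finFieldType) (K : fieldType) (iota : {rmorphism F -> K}).
Variables (v : K -> int) (pv : is_place iota v).

Lemma placeM a b : a != 0 -> b != 0 -> v (a * b) = v a + v b.
Proof. by case: pv => + _ _ _; apply. Qed.
Lemma placeC c : c != 0 -> v (iota c) = 0.
Proof. by case: pv => _ _ + _; apply. Qed.
Lemma place1 : v 1 = 0.
Proof. by rewrite -(rmorph1 iota) placeC ?oner_eq0. Qed.
Lemma placeX a n : a != 0 -> v (a ^+ n) = n%:Z * v a.
Proof.
move=> a0; elim: n => [|n IHn]; first by rewrite expr0 place1 mul0r.
by rewrite exprS placeM ?expf_neq0 // IHn; lia.
Qed.
Lemma placeV a : a != 0 -> v a^-1 = - v a.
Proof.
move=> a0; have ai0 : a^-1 != 0 by rewrite invr_eq0.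
by have := placeM a0 ai0; rewrite divff // place1; lia.
Qed.
Lemma place_div a b : a != 0 -> b != 0 -> v (a / b) = v a - v b.
Proof. by move=> a0 b0; rewrite placeM ?invr_eq0 // placeV. Qed.

(* [v 0] is junk, so that lower bounds on values are expressed by [vge]. *)
Definition vge (n : int) (f : K) : Prop := f = 0 \/ n <= v f.

Lemma vgeW n k f : k <= n -> vge n f -> vge k f.
Proof. by move=> le [->|h]; [left | right; apply: le_trans h]. Qed.

Lemma vge_neq0 n f : f != 0 -> vge n f -> n <= v f.
Proof. by move=> f0 [/eqP|//]; rewrite (negPf f0). Qed.

Lemma vgeD n a b : vge n a -> vge n b -> vge n (a + b).
Proof.
move=> [->|ha]; first by rewrite add0r.
move=> [->|hb]; first by rewrite addr0; right.
have [->|a0] := eqVneq a 0; first by rewrite add0r; right.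
have [->|b0] := eqVneq b 0; first by rewrite addr0; right.
have [->|ab0] := eqVneq (a + b) 0; first by left.
case: pv => _ /(_ a b a0 b0 ab0) h _ _; right; apply: le_trans h.
by rewrite le_min ha.
Qed.

Lemma vgeM n k a b : vge n a -> vge k b -> vge (n + k) (a * b).
Proof.
have [->|a0] := eqVneq a 0; first by rewrite mul0r; left.
have [->|b0] := eqVneq b 0; first by rewrite mulr0; left.
by move=> /(vge_neq0 a0) ha /(vge_neq0 b0) hb; right; rewrite placeM // lerD.
Qed.

Lemma vgeC c : vge 0 (iota c).
Proof.
by have [->|c0] := eqVneq c 0; [left; rewrite rmorph0 | right; rewrite placeC].
Qed.

Lemma vge_subalg : subalg iota (vge 0).
Proof. by split=> [||a b ha hb]; [apply: vgeC | apply: vgeD | rewrite -[0]addr0; apply: vgeM]. Qed.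

Lemma vgeN n a : vge n a -> vge n (- a).
Proof.
move=> ha; rewrite -mulN1r -(rmorphN1 iota) -[n]add0r.
by apply: vgeM => //; apply: vgeC.
Qed.

(** Values are integers, so [b] has strictly larger value than [a]. A larger value of [a + b] would
    force one on [a = (a + b) - b]. *)
Lemma placeD a b : a != 0 -> vge (v a + 1) b -> a + b != 0 /\ v (a + b) = v a.
Proof.
move=> a0 hb; have ab0 : a + b != 0.
  rewrite addr_eq0; apply/negP => /eqP ab.
  have : vge (v a + 1) a by rewrite {2}ab; apply: vgeN.
  by move/(vge_neq0 a0); rewrite lezD1 ltxx.
split=> //; apply/le_anti/andP; split.
  rewrite leNgt; apply/negP => lt.
  have : vge (v a + 1) a.
    by rewrite -{2}(addrK b a); apply: vgeD; [right; rewrite lezD1 | apply: vgeN].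
  by move/(vge_neq0 a0); rewrite lezD1 ltxx.
apply: vge_neq0 => //; apply: vgeD; first by right.
by apply: vgeW hb; lia.
Qed.

(** Nonzero constants have value 0, so the terms with nonzero coefficient keep their distinct values
    and exactly one of them, [g0], dominates the sum. This yields linear independence as well as
    leading terms. *)
Lemma place_sum (s : seq K) (c : K -> F) : uniq s ->
    (forall f, f \in s -> f != 0) -> {in s &, injective v} ->
    forall g, g \in s -> c g != 0 ->
  exists2 g0, g0 \in s & [/\ c g0 != 0, forall g, g \in s -> c g != 0 -> v g0 <= v g
    & vge (v g0 + 1) (\sum_(f <- s) iota (c f) * f - iota (c g0) * g0)].
Proof.
elim: s => // f s IHs /= /andP[fs us] s0 injv g gs cg0.
have f0 : f != 0 by apply: s0; rewrite mem_head.
have [/hasP[g' g's cg']|/hasPn none] := boolP (has (fun g => c g != 0) s); last first.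
  have sum0 : \sum_(f <- s) iota (c f) * f = 0.
    by rewrite big1_seq // => h /andP[_ /none]; rewrite negbK => /eqP->; rewrite rmorph0 mul0r.
  have cf0 : c f != 0.
    by move: gs cg0; rewrite inE => /orP[/eqP->//|/none/negPf->].
  exists f; first exact: mem_head.
  split=> // [h|]; last by rewrite big_cons sum0 addr0 subrr; left.
  by rewrite inE => /orP[/eqP->//|/none/negPf->].
have [||g0 g0s [cg00 ming0 hg0]] := IHs us _ _ _ g's cg'.
- by move=> h hs; apply: s0; rewrite inE hs orbT.
- by move=> h1 h2 s1 s2; apply: injv; rewrite inE ?s1 ?s2 orbT.
have [cf|cf] := eqVneq (c f) 0.
  exists g0; first by rewrite inE g0s orbT.
  split=> // [h|]; last by rewrite big_cons cf rmorph0 mul0r add0r.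
  by rewrite inE => /orP[/eqP->|]; [rewrite cf eqxx | apply: ming0].
have vcf : v (iota (c f) * f) = v f.
  by rewrite placeM ?fmorph_eq0 // placeC // add0r.
have g00 : g0 != 0 by apply: s0; rewrite inE g0s orbT.
have vcg : v (iota (c g0) * g0) = v g0.
  by rewrite placeM ?fmorph_eq0 // placeC // add0r.
case: (ltgtP (v f) (v g0)) => [lt|lt|eq].
- exists f; first exact: mem_head.
  split=> // [h|].
    by rewrite inE => /orP[/eqP->//|hs ch]; apply: le_trans (ming0 h hs ch); apply: ltW.
  rewrite big_cons [_ - _]addrC addKr -(subrK (iota (c g0) * g0) (\sum_(f <- s) _)).
  apply: vgeD; last by right; rewrite vcg lezD1.
  by apply: vgeW hg0; rewrite lerD2r ltW.
- exists g0; first by rewrite inE g0s orbT.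
  split=> // [h|].
    by rewrite inE => /orP[/eqP-> _|hs ch]; [apply: ltW | apply: ming0].
  rewrite big_cons -addrA; apply: vgeD => //; right.
  by rewrite vcf lezD1.
- have fg : f = g0 by apply: injv; rewrite ?inE ?eqxx ?g0s ?orbT.
  by rewrite fg g0s in fs.
Qed.

Lemma place_sum_value (s : seq K) (c : K -> F) (g0 : K) : c g0 != 0 -> g0 != 0 ->
    vge (v g0 + 1) (\sum_(f <- s) iota (c f) * f - iota (c g0) * g0) ->
  \sum_(f <- s) iota (c f) * f != 0 /\ v (\sum_(f <- s) iota (c f) * f) = v g0.
Proof.
move=> c0 g0n0 h.
have n0 : iota (c g0) * g0 != 0 by rewrite mulf_neq0 ?fmorph_eq0.
have vE : v (iota (c g0) * g0) = v g0.
  by rewrite placeM ?fmorph_eq0 // placeC // add0r.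
rewrite -(subrK (iota (c g0) * g0) (\sum_(f <- s) _)) addrC -vE.
by apply: placeD; rewrite // vE.
Qed.

Lemma vge_valring : valring iota (vge 0).
Proof.
split=> [|h]; first exact: vge_subalg.
have [->|h0] := eqVneq h 0; first by left; left.
by case: (leP 0 (v h)) => vh; [left; right | right; right; rewrite placeV // oppr_ge0 ltW].
Qed.

End Places.

(** * Linear spans over [F] *)

Section Spans.
Variables (F : finFieldType) (K : fieldType) (iota : {rmorphism F -> K}).
Variable P : K -> Prop.

(** The list is free of repetitions so that [place_sum] applies to it. *)
Definition Fspan (f : K) : Prop := exists (s : seq K) (c : K -> F),
  [/\ uniq s, forall g, g \in s -> P g & f = \sum_(g <- s) iota (c g) * g].

Lemma Fspan0 : Fspan 0.
Proof. by exists [::], (fun=> 0); split; rewrite ?big_nil. Qed.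

Lemma Fspan_cons a g f : P g -> Fspan f -> Fspan (iota a * g + f).
Proof.
move=> Pg [s [c [us Ps ->]]].
have [gs|gs] := boolP (g \in s).
  exists s, (fun h => if h == g then a + c g else c h); split=> //.
  rewrite !(bigD1_seq g gs us) /= eqxx rmorphD mulrDl addrA; congr (_ + _).
  by apply: eq_bigr => h /negPf->.
exists (g :: s), (fun h => if h == g then a else c h); split=> /=.
- by rewrite gs.
- by move=> h; rewrite inE => /orP[/eqP->|/Ps].
- rewrite big_cons eqxx; congr (_ + _); rewrite !big_seq; apply: eq_bigr => h hs.
  by case: eqP => // hg; rewrite -hg hs in gs.
Qed.


Lemma FspanD f g : Fspan f -> Fspan g -> Fspan (f + g).
Proof.
case=> s [c [_ Ps ->]] sg; elim: s Ps => [|h s IHs] Ps; first by rewrite big_nil add0r.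
rewrite big_cons -addrA; apply: Fspan_cons; first by apply: Ps; rewrite mem_head.
by apply: IHs => k ks; apply: Ps; rewrite inE ks orbT.
Qed.

Lemma mem_Fspan a g : P g -> Fspan (iota a * g).
Proof. by move=> Pg; rewrite -[X in Fspan X]addr0; apply: Fspan_cons Pg Fspan0. Qed.

Lemma FspanZ a f : Fspan f -> Fspan (iota a * f).
Proof.
case=> s [c [us Ps ->]]; exists s, (fun g => a * c g); split=> //.
by rewrite mulr_sumr; apply: eq_bigr => g _; rewrite rmorphM mulrA.
Qed.

Lemma FspanM f g : (forall h k, P h -> P k -> Fspan (h * k)) ->
  Fspan f -> Fspan g -> Fspan (f * g).
Proof.
move=> PM [s [c [_ Ps ->]]] [s' [c' [_ Ps' ->]]].
rewrite mulr_suml big_seq; elim/big_rec: _ => [|h a hs sa]; first exact: Fspan0.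
apply: FspanD => //; rewrite -mulrA mulr_sumr; apply: FspanZ.
rewrite big_seq; elim/big_rec: _ => [|k b ks sb]; first exact: Fspan0.
apply: FspanD => //; rewrite mulrCA; apply: FspanZ; apply: PM; first exact: Ps.
exact: Ps'.
Qed.

End Spans.

Lemma Fspan_mulr (F : finFieldType) (K : fieldType) (iota : {rmorphism F -> K})
    (P Q : K -> Prop) (u f : K) :
  (forall g, P g -> Q (g * u)) -> Fspan iota P f -> Fspan iota Q (f * u).
Proof.
move=> PQ [s [c [_ Ps ->]]]; elim: s Ps => [|h s IHs] Ps.
  by rewrite big_nil mul0r; apply: Fspan0.
rewrite big_cons mulrDl -mulrA; apply: Fspan_cons.
  by apply: PQ; apply: Ps; rewrite mem_head.
by apply: IHs => k ks; apply: Ps; rewrite inE ks orbT.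
Qed.

(** * The Suzuki curve *)

Section SuzukiCurve.
Variables (m q0 q : nat).
Hypotheses (hm : (1 <= m)%N) (hq0 : q0 = (2 ^ m)%N) (hq : q = (2 ^ (2 * m + 1))%N).
Variables (F : finFieldType) (K : fieldType) (iota : {rmorphism F -> K}) (x y : K).
Hypotheses (hF : #|F| = q) (hcurve : y ^+ q + y = x ^+ q0 * (x ^+ q + x)).
Hypothesis htrans : forall p : {poly F}, (map_poly iota p).[x] = 0 -> p = 0.
Hypothesis hgen : forall f : K, exists p r : {poly {poly F}},
  ev2 iota x y r != 0 /\ f = ev2 iota x y p / ev2 iota x y r.

(** * The ring [F[x,y]], its integrality over [F[x]], and denominators *)

Let comm_x : commr_rmorph iota x. Proof. by move=> c; apply: mulrC. Qed.
Let ev : {rmorphism {poly F} -> K} := horner_morph comm_x.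
Let comm_y : commr_rmorph ev y. Proof. by move=> c; apply: mulrC. Qed.

Lemma evX : ev 'X = x. Proof. exact: horner_morphX. Qed.
Lemma evC c : ev c%:P = iota c. Proof. exact: horner_morphC. Qed.
Lemma ev_eq0 p : (ev p == 0) = (p == 0).
Proof. by apply/eqP/eqP => [/htrans//|->]; rewrite rmorph0. Qed.

Lemma ev2E p : ev2 iota x y p = horner_morph comm_y p.
Proof. by rewrite /horner_morph /map_poly horner_poly. Qed.

(** Membership in [R = F[x,y]]: the inner variable of [p] becomes [x], the outer one [y]. *)
Definition coord (f : K) : Prop := exists p, f = horner_morph comm_y p.

Lemma coord_ev p : coord (ev p).
Proof. by exists p%:P; rewrite horner_morphC. Qed.

Lemma coord_subalg : subalg iota coord.
Proof.
split=> [c|a b [p ->] [r ->]|a b [p ->] [r ->]].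
- by rewrite -evC; apply: coord_ev.
- by exists (p + r); rewrite rmorphD.
- by exists (p * r); rewrite rmorphM.
Qed.

Lemma coord_x : coord x. Proof. by rewrite -evX; apply: coord_ev. Qed.
Lemma coord_y : coord y. Proof. by exists 'X; rewrite horner_morphX. Qed.

(** This also serves as an induction principle on [R], with [A] the property to be proved. *)
Lemma sub_coord (A : K -> Prop) : subalg iota A -> A x -> A y -> forall f, coord f -> A f.
Proof.
move=> algA Ax Ay f [p ->].
have Aev r : A (ev r).
  elim/poly_ind: r => [|r c Ar]; first by rewrite rmorph0; apply: (subalg0 algA).
  rewrite rmorphD rmorphM /= evX evC; apply: (subalgD algA); last exact: (subalgC algA).
  exact: (subalgM algA).
elim/poly_ind: p => [|p r Ap]; first by rewrite rmorph0; apply: (subalg0 algA).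
rewrite rmorphD rmorphM /= horner_morphX horner_morphC.
by apply: (subalgD algA) => //; apply: (subalgM algA).
Qed.

Lemma coord_horner (p : {poly {poly F}}) b : coord b -> coord (map_poly ev p).[b].
Proof.
move=> cb; elim/poly_ind: p => [|p c cp].
  by rewrite rmorph0 horner0; apply: (subalg0 coord_subalg).
rewrite rmorphD rmorphM /= map_polyX map_polyC hornerMXaddC.
by apply: (subalgD coord_subalg); [apply: (subalgM coord_subalg) | apply: coord_ev].
Qed.

Lemma q_double : q = (2 * q0 ^ 2)%N.
Proof. by rewrite hq hq0 addn1 expnS -expnM [(m * 2)%N]mulnC. Qed.
Lemma q0_gt1 : (1 < q0)%N.
Proof. by rewrite hq0 -{1}(expn0 2) ltn_exp2l. Qed.
Lemma q_gt1 : (1 < q)%N.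
Proof. by have := q_double; have := q0_gt1; nia. Qed.

Lemma charF : 2 \in [pchar F].
Proof. by apply: (card_finPcharP (n := (2 * m + 1)%N)); rewrite // hF hq. Qed.
Lemma charK : 2 \in [pchar K]. Proof. exact: (rmorph_pchar iota charF). Qed.
Lemma addKK (a : K) : a + a = 0. Proof. exact: (addrr_pchar2 charK). Qed.
Lemma oppK (a : K) : - a = a. Proof. exact: (oppr_pchar2 charK). Qed.

Lemma pow2D k (a b : K) : (a + b) ^+ (2 ^ k) = a ^+ (2 ^ k) + b ^+ (2 ^ k).
Proof. by apply: exprDn_pchar; rewrite pnatX pnatE // charK. Qed.
Lemma q0D (a b : K) : (a + b) ^+ q0 = a ^+ q0 + b ^+ q0.
Proof. by rewrite hq0 pow2D. Qed.
Lemma qD (a b : K) : (a + b) ^+ q = a ^+ q + b ^+ q.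
Proof. by rewrite hq pow2D. Qed.
Lemma q0I (a b : K) : a ^+ q0 = b ^+ q0 -> a = b.
Proof.
move=> E; have: (a + b) ^+ q0 == 0 by rewrite q0D E addKK.
by rewrite expf_eq0 addr_eq0 oppK => /andP[_ /eqP].
Qed.

(** The curve equation [G] is monic of degree [q] in [y], so [1, y, ..., y^(q-1)] generate [R] over
    [F[x]]. The polynomial wanted is the characteristic polynomial of a matrix [M] of multiplication
    by [b] on these generators. *)
Lemma coord_charpoly b : coord b ->
  exists p : {poly {poly F}}, [/\ p \is monic, size p = q.+1 & root (map_poly ev p) b].
Proof.
move=> cb.
pose C : {poly F} := 'X^q0 * ('X^q + 'X).
pose G : {poly {poly F}} := 'X^q + ('X - C%:P).
have evC' : ev C = y ^+ q + y.
  by rewrite rmorphM rmorphD !rmorphXn /= evX hcurve.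
have szG : size G = q.+1.
  by rewrite size_polyDl ?size_polyXn // size_XsubC ltnS q_gt1.
have monG : G \is monic.
  by rewrite monicE lead_coefDl ?lead_coefXn // size_polyXn size_XsubC ltnS q_gt1.
have yG : horner_morph comm_y G = 0.
  rewrite rmorphD rmorphB rmorphXn /= horner_morphX horner_morphC.
  by rewrite evC' addrA subrr.
have rep a : coord a -> exists r : {poly {poly F}},
    (size r <= q)%N /\ a = \sum_(i < q) ev r`_i * y ^+ i.
  case=> p ->; exists (Pdiv.Ring.rmodp p G).
  have sz : (size (Pdiv.Ring.rmodp p G) <= q)%N.
    by rewrite -ltnS -szG Pdiv.Ring.ltn_rmodp monic_neq0.
  split=> //; rewrite {1}(Pdiv.RingMonic.rdivp_eq monG p) rmorphD rmorphM /= yG mulr0 add0r.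
  rewrite -[LHS]/((map_poly ev _).[y]) (@horner_coef_wide _ q);
    last exact: leq_trans (size_poly _ _) sz.
  by apply: eq_bigr => i _; rewrite coef_map.
have cby (j : 'I_q) : coord (b * y ^+ j).
  by apply: (subalgM coord_subalg) => //; apply: (subalgX coord_subalg); apply: coord_y.
have /choice[r Hr] : forall j : 'I_q, exists r : {poly {poly F}},
    b * y ^+ j = \sum_(i < q) ev r`_i * y ^+ i.
  by move=> j; have [r [_ Er]] := rep _ (cby j); exists r.
pose M : 'M[{poly F}]_q := \matrix_(i, j) (r j)`_i.
exists (char_poly M); split; [exact: char_poly_monic | exact: size_char_poly |].
rewrite map_char_poly -eigenvalue_root_char; apply/eigenvalueP.
exists (\row_i y ^+ i).
  apply/rowP => j; rewrite !mxE Hr; apply: eq_bigr => i _.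
  by rewrite !mxE mulrC.
have q_gt0 : (0 < q)%N by apply: ltnW q_gt1.
apply/eqP => /rowP/(_ (Ordinal q_gt0)); rewrite !mxE /= expr0 => /eqP.
by rewrite oner_eq0.
Qed.

(** In an integral equation of [b] with nonzero constant term [c], the term [c] is a multiple of [b]
    in [R]. A zero constant term is removed by dividing the equation by [b]. *)
Lemma coord_denominator b : coord b -> b != 0 ->
  exists2 r : {poly F}, r != 0 & coord (ev r / b).
Proof.
move=> cb b0; have [p [/monic_neq0 p0 _]] := coord_charpoly cb.
elim/poly_ind: p p0 => [|p c IHp]; first by rewrite eqxx.
have -> : root (map_poly ev (p * 'X + c%:P)) b = ((map_poly ev p).[b] * b + ev c == 0).
  by rewrite /root rmorphD rmorphM /= map_polyX map_polyC hornerMXaddC.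
have [->|c0] := eqVneq c 0.
  rewrite polyC0 addr0 (rmorph0 ev) addr0 [_ * b == 0]mulf_eq0 (negPf b0) orbF => p0.
  by apply: IHp; apply: contraNneq p0 => ->; rewrite mul0r.
move=> _; rewrite addr_eq0 => /eqP E; exists c => //.
rewrite -[ev c]opprK -E mulNr mulfK //; apply: (subalgN coord_subalg).
exact: coord_horner.
Qed.

Lemma coord_frac f : exists2 r : {poly F}, r != 0 & coord (ev r * f).
Proof.
have [p [r [r0 ->]]] := hgen f; rewrite !ev2E in r0 *.
have [|c c0 cc] := coord_denominator _ r0; first by exists r.
exists c => //; rewrite mulrCA; apply: (subalgM coord_subalg) => //.
by exists p.
Qed.

Lemma ev_coef (p : {poly F}) n : (size p <= n)%N -> ev p = \sum_(i < n) iota p`_i * x ^+ i.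
Proof.
move=> szp; rewrite -[LHS]/((map_poly iota p).[x]) (@horner_coef_wide _ n).
  by apply: eq_bigr => i _; rewrite coef_map.
exact: leq_trans (size_poly _ _) szp.
Qed.

Lemma x_neq0 : x != 0.
Proof. by rewrite -evX ev_eq0 polyX_eq0. Qed.

(** * Valuation rings of [K] other than [K] come from places *)

Section PlaceExistence.
Variables (A : K -> Prop) (valA : valring iota A) (g : K) (nAg : ~ A g).

Let algA : subalg iota A. Proof. by case: valA. Qed.

(** Otherwise [y^-1] lies in [A], and the curve equation divided by [y^(q-1)] expresses [y] through
    [x] and [y^-1]. *)
Lemma valring_y : A x -> A y.
Proof.
move=> Ax; case: (valA.2 y) => // Ayi.
have [->|y0] := eqVneq y 0; first exact: (subalg0 algA).
have [n qE] : exists n, q = n.+2 by case: (q) q_gt1 => [|[|n]] // _; exists n.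
have E1 : y * y^-1 ^+ n.+1 = y^-1 ^+ n by rewrite exprS mulVKf.
have E2 : y ^+ q * y^-1 ^+ n.+1 = y.
  by rewrite qE exprS -mulrA -exprMn divff // expr1n mulr1.
have -> : y = (x ^+ q0 * (x ^+ q + x)) * y^-1 ^+ n.+1 - y^-1 ^+ n.
  by rewrite -hcurve mulrDl E1 E2 addrK.
apply: (subalgB algA); last exact: (subalgX algA).
apply: (subalgM algA); last exact: (subalgX algA).
by apply: (subalgM algA); [|apply: (subalgD algA)] => //; apply: (subalgX algA).
Qed.

Lemma valring_coord : A x -> forall f, coord f -> A f.
Proof. by move=> Ax; apply: sub_coord => //; apply: valring_y. Qed.

(** Here [tau] is a uniformizer for the trace of [A] on [F(x)]. If [x] is not in [A], it is [x^-1],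
    and [p * x^-(deg p)] is the leading coefficient plus nonunits. Otherwise it is a polynomial [pi]
    of least degree among the nonunits of [F[x]]: nonzero remainders modulo [pi] are units. *)
Lemma valring_uniformizer : exists tau : K, [/\ tau != 0, nonunitA A tau &
  forall p, p != 0 -> exists k : int, unitA A (ev p * tau ^ k)].
Proof.
have [Ax|nAx] := pselect (A x); last first.
  exists x^-1; split; [by rewrite invr_eq0 x_neq0 | by right; rewrite invrK |].
  have mx : nonunitA A x^-1 by right; rewrite invrK.
  move=> p p0; exists (size p).-1%:Z; rewrite -exprnP.
  have sp : size p = (size p).-1.+1 by rewrite prednK // size_poly_gt0.
  rewrite (@ev_coef p (size p).-1.+1); last by rewrite -sp.
  rewrite big_ord_recr /= mulrDl addrC.
  rewrite -mulrA -exprMn divff ?x_neq0 // expr1n mulr1.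
  apply: (unitAD valA); first by apply: (unitAC valA); rewrite -lead_coefE lead_coef_eq0.
  rewrite mulr_suml; apply: (nonunitA_sum valA) => i _; rewrite -mulrA.
  apply: (nonunitAM valA); first exact: (subalgC algA).
  rewrite -{2}(subnKC (ltnW (ltn_ord i))) exprD mulrA -exprMn divff ?x_neq0 // expr1n mul1r.
  have : (0 < (size p).-1 - i)%N by rewrite subn_gt0.
  case: (_ - _)%N => // n _; rewrite exprSr; apply: (nonunitAM valA) => //.
  by apply: (subalgX algA); exact: (nonunitA_sub valA mx).
pose P := [pred n : nat | `[< exists2 p : {poly F}, p != 0 & nonunitA A (ev p) /\ size p = n >]].
(* A denominator of [g] in [F[x]] cannot be a unit, since [g] is not in [A]. *)
have exP : exists n, P n.
  have [r r0 cr] := coord_frac g.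
  exists (size r); apply/asboolP; exists r => //; split=> //.
  have er0 : ev r != 0 by rewrite ev_eq0.
  right => Ari; apply: nAg; rewrite -(mulKf er0 g).
  by apply: (subalgM algA) => //; apply: valring_coord.
case: (ex_minnP exP) => d /asboolP[pi pi0 [mpi szpi]] dmin.
exists (ev pi); split=> //; first by rewrite ev_eq0.
have small (p : {poly F}) : p != 0 -> (size p < size pi)%N -> unitA A (ev p).
  move=> p0 lt; have [//|mp] : unitA A (ev p) \/ nonunitA A (ev p).
    by apply: unitA_or_max; apply: valring_coord => //; apply: coord_ev.
  have /dmin : P (size p) by apply/asboolP; exists p.
  by rewrite -szpi leqNgt lt.
have szpi1 : (1 < size pi)%N.
  rewrite ltnNge; apply/negP => /size1_polyC piE.
  have c0 : pi`_0 != 0 by apply: contraNneq pi0 => c0; rewrite piE c0.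
  apply: (nonunitA_not_unit (unitAC valA c0)).
  by rewrite -evC -piE.
move=> p; have [n] := ubnP (size p); elim: n p => // n IHn p ltpn p0.
have E := divp_eq p pi; have [r0|r0] := eqVneq (p %% pi) 0.
  rewrite r0 addr0 in E.
  have d0 : p %/ pi != 0 by apply: contraNneq p0 => d0; rewrite E d0 mul0r.
  have [|k uk] := IHn _ _ d0.
    have : size p = (size (p %/ pi) + size pi).-1 by rewrite {1}E size_mul.
    move: d0; rewrite -size_poly_gt0 => d0 szE.
    by move: (size p) (size pi) (size (p %/ pi)) ltpn szpi1 d0 szE; lia.
  exists (k - 1); rewrite E rmorphM /= expfzDr ?ev_eq0 // -mulrA mulrCA.
  rewrite [_ ^ (-1)]exprN1 mulrC -!mulrA mulVf ?ev_eq0 // mulr1.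
  by [].
exists 0; rewrite expr0z mulr1 E rmorphD rmorphM /= addrC.
apply: (unitAD valA); first by apply: small => //; rewrite ltn_modp.
by apply: (nonunitAM valA) => //; apply: valring_coord => //; apply: coord_ev.
Qed.

(** In the monic equation of degree [q] satisfied by [b] in [R], two terms have the same value, so
    [b^(i - j)] is a power of [tau] up to a unit with [0 < i - j <= q]. The exponent [q!] is a
    multiple of every such difference and hence works for all [b]; quotients then cover [K]. *)
Theorem place_of_curve_valring :
  exists2 v : K -> int, is_place iota v & forall h, h != 0 -> (A h <-> 0 <= v h).
Proof.
have [tau [tau0 mtau Htau]] := valring_uniformizer.
apply: (@place_of_valring F K iota A valA tau q`!) => //; first exact: fact_gt0.
have Hc b : coord b -> b != 0 -> exists k : int, unitA A (b ^+ q`! * tau ^ k).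
  move=> cb b0; have [p [monp szp /rootP rb]] := coord_charpoly cb.
  pose E (i : 'I_q.+1) := ev p`_i * b ^+ i.
  have sumE : \sum_i E i = 0.
    rewrite -[RHS]rb (@horner_coef_wide _ q.+1); last by rewrite -szp size_poly.
    by apply: eq_bigr => i _; rewrite coef_map.
  have Emax : E ord_max != 0.
    rewrite /E /= -[q]/(q.+1.-1) -szp -lead_coefE (monicP monp) rmorph1 mul1r.
    exact: expf_neq0.
  have [i [j [ij Ej0 uij]]] := sum0_same_value valA Emax sumE.
  have step (i' j' : 'I_q.+1) : (j' < i')%N -> unitA A (E i' / E j') ->
      exists k : int, unitA A (b ^+ q`! * tau ^ k).
    move=> lt u; have [u0 _ _] := u.
    have [Ei0 Ej'0] : E i' != 0 /\ E j' != 0.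
      by move: u0; rewrite mulf_eq0 invr_eq0 negb_or => /andP[].
    have [ei0 ej0] : p`_i' != 0 /\ p`_j' != 0.
      by split; [move: Ei0 | move: Ej'0]; rewrite mulf_eq0 ev_eq0 => /norP[].
    have [k1 u1] := Htau _ ei0; have [k2 u2] := Htau _ ej0.
    have uk : unitA A (b ^+ (i' - j') * tau ^ (k2 - k1)).
      rewrite (_ : _ * _ = (E i' / E j') * ((ev p`_j' * tau ^ k2) / (ev p`_i' * tau ^ k1))).
        by apply: (unitAM valA) => //; apply: (unitAM valA) => //; apply: unitAV.
      have bE : b ^+ i' = b ^+ (i' - j') * b ^+ j' by rewrite -exprD subnK // ltnW.
      rewrite /E bE expfzDr // -invr_expz.
      by field; rewrite !ev_eq0 ei0 ej0 expf_neq0 // expfz_neq0.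
    have /dvdnP[e ->] : (i' - j' %| q`!)%N.
      by apply: dvdn_fact; rewrite subn_gt0 lt (leq_trans (leq_subr _ _)) // -ltnS.
    exists ((k2 - k1) * e%:Z).
    by rewrite mulnC exprM -exprz_exp -exprnP -exprMn; apply: (unitAX valA).
  have [lt|lt|/val_inj eq] := ltngtP i j; first 1 last.
  - exact: step uij.
  - by rewrite eq eqxx in ij.
  - by apply: (step j i) => //; rewrite -invf_div; apply: unitAV.
move=> h h0; have [p [r [r0 E]]] := hgen h; rewrite !ev2E in r0 E.
have p0 : horner_morph comm_y p != 0 by apply: contraNneq h0 => p0; rewrite E p0 mul0r.
have [|k1 u1] := Hc _ _ p0; first by exists p.
have [|k2 u2] := Hc _ _ r0; first by exists r.
exists (k1 - k2).
have -> : h ^+ q`! * tau ^ (k1 - k2) = (horner_morph comm_y p ^+ q`! * tau ^ k1)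
    / (horner_morph comm_y r ^+ q`! * tau ^ k2).
  by rewrite E expfzDr // expr_div_n -invr_expz invfM mulrACA.
by apply: (unitAM valA) => //; apply: unitAV.
Qed.

End PlaceExistence.

(** * Relations between [x], [y], [z] and [w] *)

Let t := x ^+ q + x.
Let z := x ^+ (2 * q0 + 1) - y ^+ (2 * q0).
Let w := x * y ^+ (2 * q0) - z ^+ (2 * q0).

Lemma evt : ev ('X^q + 'X) = t. Proof. by rewrite rmorphD rmorphXn /= evX. Qed.
Lemma t_neq0 : t != 0.
Proof.
rewrite -evt ev_eq0 -size_poly_eq0 size_polyDl ?size_polyXn //.
by rewrite size_polyX ltnS q_gt1.
Qed.

Lemma y_q : y ^+ q = x ^+ q0 * t + y.
Proof. by rewrite -hcurve -addrA addKK addr0. Qed.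

(** Since [2 * q0 * q0 = q], raising [z] to the power [q0] produces [y^q], which the curve equation
    reduces. *)
Lemma z_q0 : z ^+ q0 = y + x ^+ (q0 + 1).
Proof.
rewrite /z oppK q0D -!exprM.
have -> : (2 * q0 * q0 = q)%N by rewrite q_double; lia.
have -> : ((2 * q0 + 1) * q0 = q0 + q)%N by rewrite q_double; lia.
rewrite y_q /t mulrDr !exprD expr1 !addrA addKK add0r.
by rewrite addrC.
Qed.

Lemma double_q0D (a b : K) : (a + b) ^+ (2 * q0) = a ^+ (2 * q0) + b ^+ (2 * q0).
Proof. by rewrite hq0 -expnS pow2D. Qed.

Lemma w_q0 : w ^+ q0 = z + x ^+ q0 * y.
Proof.
rewrite /w oppK q0D exprMn -!exprM.
have -> : (2 * q0 * q0 = q)%N by rewrite q_double; lia.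
have -> : z ^+ q = (y + x ^+ (q0 + 1)) ^+ (2 * q0).
  by rewrite -z_q0 -exprM; congr (_ ^+ _); rewrite q_double; lia.
rewrite double_q0D -exprM y_q.
have -> : ((q0 + 1) * (2 * q0) = q + (2 * q0))%N by rewrite q_double; lia.
rewrite /z oppK /t exprD [x ^+ (2 * q0 + 1)]exprD expr1 mul2n -addnn !exprD.
set X := x ^+ q0; set Y := y ^+ q0; set Q := x ^+ q.
(* A pair of equal terms, zero in characteristic 2, is added where it is missing, so that both sides
   agree as integer polynomials. *)
rewrite -[RHS]addr0 -(addKK (X * X * Q)); ring.
Qed.

(** The power [q0] is injective in characteristic 2, and after it both sides become [z + x^(2q0+1)]
    by [z_q0] and [w_q0]. *)
Lemma y_sqr : y ^+ 2 = w + x * z.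
Proof.
apply: q0I; rewrite q0D [(x * z) ^+ q0]exprMn z_q0 w_q0 -exprM /z oppK mul2n -addnn.
rewrite !exprD !expr1; set X := x ^+ q0; set Y := y ^+ q0.
rewrite -[LHS]addr0 -(addKK (X * X * x)) -[LHS]addr0 -(addKK (X * y)); ring.
Qed.


Lemma y_neq0 : y != 0.
Proof.
apply: contraTneq isT => y0; have := hcurve; rewrite y0 expr0n.
rewrite (gtn_eqF (ltnW q_gt1)) addr0 => /esym/eqP.
by rewrite mulf_eq0 (negPf t_neq0) expf_eq0 (negPf x_neq0) andbF.
Qed.

Lemma coord_z : coord z.
Proof.
apply: (subalgB coord_subalg); apply: (subalgX coord_subalg);
  [exact: coord_x | exact: coord_y].
Qed.
Lemma coord_w : coord w.
Proof.
apply: (subalgB coord_subalg); last by apply: (subalgX coord_subalg); exact: coord_z.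
apply: (subalgM coord_subalg); first exact: coord_x.
by apply: (subalgX coord_subalg); exact: coord_y.
Qed.

(** * Values of the coordinate functions at a pole of [x] *)

Section PoleOfX.
Variables (v : K -> int) (pv : is_place iota v) (vx : v x < 0).

(** In each of the relations for [y^q], [z^q0] and [w^q0] a single term dominates at a pole of [x],
    which makes all values rational multiples of [v x]. *)
Lemma infinite_place_values : exists k : int, [/\ 0 < k,
  [/\ z != 0 & w != 0], v x = - (q%:Z * k) /\ v y = - ((q + q0)%:Z * k),
  v z = - ((q + 2 * q0)%:Z * k) & v w = - ((q + 2 * q0 + 1)%:Z * k)].
Proof.
have q02 := q0_gt1; have q1 := q_gt1; have qE := q_double.
have x0 := x_neq0; have y0 := y_neq0.
have [_ vt] : t != 0 /\ v t = q%:Z * v x.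
  rewrite /t -(placeX pv) //; apply: (placeD pv); first exact: expf_neq0.
  by right; rewrite (placeX pv) //; nia.
have vrhs : v (y ^+ q + y) = q0%:Z * v x + q%:Z * v x.
  by rewrite hcurve (placeM pv) ?expf_neq0 ?t_neq0 // vt (placeX pv).
have vyq : q%:Z * v y = q0%:Z * v x + q%:Z * v x.
  (* If [v y >= 0], the left side of the curve equation has no pole while the right side has one. *)
  have [vy|vy] := ltP (v y) 0.
    rewrite -vrhs -(placeX pv) //; apply/esym.
    apply: (placeD pv _ _).2; first exact: expf_neq0.
    by right; rewrite (placeX pv) //; nia.
  have : vge v 0 (y ^+ q + y).
    apply: (vgeD pv); last by right.
    by right; rewrite (placeX pv) //; nia.
  move/vge_neq0; rewrite vrhs {1}hcurve mulf_neq0 ?expf_neq0 ?t_neq0 // => /(_ isT).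
  by nia.
have vy : 2 * q0%:Z * v y = (1 + 2 * q0%:Z) * v x.
  by apply: (@mulfI _ q0%:Z); [lia | rewrite qE in vyq; lia].
have vxq : v (x ^+ (q0 + 1)) = (q0%:Z + 1) * v x by rewrite (placeX pv) //; lia.
have [zq0 vzq] : z ^+ q0 != 0 /\ v (z ^+ q0) = (q0%:Z + 1) * v x.
  rewrite z_q0 addrC -vxq; apply: (placeD pv); first exact: expf_neq0.
  by right; rewrite vxq; nia.
have z0 : z != 0 by move: zq0; rewrite expf_eq0; case: (z == 0); rewrite // andbT; lia.
have vz : q0%:Z * v z = (q0%:Z + 1) * v x by rewrite -vzq (placeX pv).
have vxy : v (x ^+ q0 * y) = q0%:Z * v x + v y.
  by rewrite (placeM pv) ?expf_neq0 // (placeX pv).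
have [wq0 vwq] : w ^+ q0 != 0 /\ v (w ^+ q0) = q0%:Z * v x + v y.
  rewrite w_q0 addrC -vxy; apply: (placeD pv); first by rewrite mulf_neq0 ?expf_neq0.
  by right; rewrite vxy; nia.
have w0 : w != 0 by move: wq0; rewrite expf_eq0; case: (w == 0); rewrite // andbT; lia.
have vw : q0%:Z * v w = q0%:Z * v x + v y by rewrite -vwq (placeX pv).
have vw2 : 2 * q0%:Z ^+ 2 * (v w - v x) = (1 + 2 * q0%:Z) * v x.
  by rewrite -vy; nia.
(* A Bezout combination: [v x] and [v w - v x] are to be [-q k] and [-(2q0+1) k], and
   [2q - (2q0-1)(2q0+1) = 1]. *)
pose k := - (2 * v x + (v w - v x) * (1 - 2 * q0%:Z)).
have vxk : v x = - (q%:Z * k).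
  by rewrite qE /k; nia.
have kpos : 0 < k by nia.
exists k; split=> //; first split=> //.
- by apply: (@mulfI _ (2 * q0%:Z)); [lia | rewrite vy vxk qE; nia].
- by apply: (@mulfI _ q0%:Z); [lia | rewrite vz vxk qE; nia].
- by apply: (@mulfI _ (2 * q0%:Z ^+ 2)); [nia | nia].
Qed.

End PoleOfX.

(** * Reduced monomials and their weights *)

Definition monomial (k a b c d : nat) : K := t ^+ k * x ^+ a * y ^+ b * z ^+ c * w ^+ d.

(** The pole order at infinity, where [t] has a pole of order [q^2]; see
    [infinite_place_monomial]. *)
Definition weight (k a b c d : nat) : nat :=
  (k * q ^ 2 + (a * q + b * (q + q0) + c * (q + 2 * q0) + d * (q + 2 * q0 + 1)))%N.

Definition reduced (f : K) : Prop := exists k a b c d : nat,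
  [/\ [/\ (a < q)%N, (b < 2)%N, (c < q0)%N & (d < q0)%N] & f = monomial k a b c d].

(** The relations for [y^2], [z^q0] and [w^q0] lower [b + c + d] while possibly raising [a]; then
    [x^q = t + x] lowers [a] and leaves [b + c + d] unchanged. Hence the lexicographic induction on
    [b + c + d], then [a]. *)
Lemma monomial_Fspan k a b c d : Fspan iota reduced (monomial k a b c d).
Proof.
have q02 := q0_gt1; have q1 := q_gt1.
have [n] := ubnP (b + c + d); elim: n k a b c d => // n IHn k a b c d.
have [l] := ubnP a; elim: l k a b c d => // l IHl k a b c d lta ltn.
have two f g h : f = g + h -> Fspan iota reduced g -> Fspan iota reduced h -> Fspan iota reduced f.
  by move=> ->; apply: FspanD.
have [b2|b2] := leqP 2 b.
  apply: (two _ (monomial k a (b - 2) c d.+1) (monomial k a.+1 (b - 2) c.+1 d)).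
  - rewrite /monomial -{1}(subnK b2) exprD y_sqr !exprS; ring.
  - by apply: IHn; lia.
  - by apply: IHn; lia.
have [c2|c2] := leqP q0 c.
  apply: (two _ (monomial k a b.+1 (c - q0) d) (monomial k (a + (q0 + 1)) b (c - q0) d)).
  - rewrite /monomial -{1}(subnK c2) exprD z_q0 [x ^+ (a + _)]exprD [y ^+ _.+1]exprS; ring.
  - by apply: IHn; lia.
  - by apply: IHn; lia.
have [d2|d2] := leqP q0 d.
  apply: (two _ (monomial k a b c.+1 (d - q0)) (monomial k (a + q0) b.+1 c (d - q0))).
  - rewrite /monomial -{1}(subnK d2) exprD w_q0 [x ^+ (a + _)]exprD.
    rewrite [y ^+ _.+1]exprS [z ^+ _.+1]exprS; ring.
  - by apply: IHn; lia.
  - by apply: IHn; lia.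
have [a2|a2] := leqP q a.
  apply: (two _ (monomial k.+1 (a - q) b c d) (monomial k (a - q).+1 b c d)).
  - have xq : x ^+ q = t + x by rewrite /t -addrA addKK addr0.
    rewrite /monomial -{1}(subnK a2) exprD xq [t ^+ _.+1]exprS [x ^+ _.+1]exprS; ring.
  - by apply: IHl; lia.
  - by apply: IHl; lia.
rewrite -[X in Fspan _ _ X]mul1r -(rmorph1 iota); apply: mem_Fspan.
by exists k, a, b, c, d.
Qed.

Lemma coord_Fspan f : coord f -> Fspan iota reduced f.
Proof.
apply: sub_coord.
- split=> [e|f1 f2|f1 f2]; first 1 last.
  + exact: FspanD.
  + apply: FspanM => _ _ [k [a [b [c [d [_ ->]]]]]] [k' [a' [b' [c' [d' [_ ->]]]]]].
    rewrite (_ : _ * _ = monomial (k + k') (a + a') (b + b') (c + c') (d + d')).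
      exact: monomial_Fspan.
    by rewrite /monomial !exprD; ring.
  + rewrite -[iota e]mulr1; apply: FspanZ.
    by have := monomial_Fspan 0 0 0 0 0; rewrite /monomial !expr0 !mulr1.
- by have := monomial_Fspan 0 1 0 0 0; rewrite /monomial !expr0 !mulr1 mul1r.
- by have := monomial_Fspan 0 0 1 0 0; rewrite /monomial !expr0 !mulr1 !mul1r.
Qed.

Lemma divmod_inj (n u u' r r' : nat) : (r < n)%N -> (r' < n)%N ->
  (u * n + r = u' * n + r')%N -> u = u' /\ r = r'.
Proof.
move=> rn r'n E; have := congr1 (edivn^~ n) E; rewrite !edivn_eq //.
by case=> -> ->.
Qed.

(** The exponents are the digits of the weight in a mixed radix: successive divisions by [q0], 2,
    [q0] and [q] give back [d], [b], [c] and [a], after known digits are cancelled. *)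
Lemma weight_inj k a b c d k' a' b' c' d' :
  [/\ (a < q)%N, (b < 2)%N, (c < q0)%N & (d < q0)%N] ->
  [/\ (a' < q)%N, (b' < 2)%N, (c' < q0)%N & (d' < q0)%N] ->
  weight k a b c d = weight k' a' b' c' d' ->
  [/\ k = k', a = a', b = b', c = c' & d = d'].
Proof.
move=> [ha hb hc hd] [ha' hb' hc' hd']; rewrite /weight => E.
pose h k1 a1 b1 c1 d1 := (k1 * (2 * q * q0) + a1 * 2 * q0 + b1 * (2 * q0 + 1) + c1 * (2 * q0 + 2)
  + d1 * (2 * q0 + 2))%N.
have wE k1 a1 b1 c1 d1 : (k1 * q ^ 2 + (a1 * q + b1 * (q + q0) + c1 * (q + 2 * q0)
    + d1 * (q + 2 * q0 + 1)) = h k1 a1 b1 c1 d1 * q0 + d1)%N.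
  by rewrite /h expnS expn1 {2 3 4 5 6}q_double; nia.
rewrite !wE in E; have [{}E dd] := divmod_inj hd hd' E; subst d'.
pose h2 k1 a1 b1 c1 := (k1 * (q * q0) + a1 * q0 + b1 * q0 + c1 * (q0 + 1) + d * (q0 + 1))%N.
have h2E k1 a1 b1 c1 : h k1 a1 b1 c1 d = (h2 k1 a1 b1 c1 * 2 + b1)%N by rewrite /h /h2; nia.
rewrite !h2E in E; have [{}E bb] := divmod_inj hb hb' E; subst b'.
have {}E : ((k * q + a + c) * q0 + c = (k' * q + a' + c') * q0 + c')%N.
  by move: E; rewrite /h2; nia.
have [{}E cc] := divmod_inj hc hc' E; subst c'.
have {}E : (k * q + a = k' * q + a')%N by lia.
by have [-> ->] := divmod_inj ha ha' E.
Qed.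

(** * Leading monomials and rationality at a pole of [x] *)

Section InfinitePlace.
Variables (v : K -> int) (pv : is_place iota v) (vx : v x < 0).

Lemma infinite_place_weight : exists2 n : int, 0 < n &
  [/\ z != 0, w != 0 & forall k a b c d, v (monomial k a b c d) = - (n * (weight k a b c d)%:Z)].
Proof.
have [n [n0 [z0 w0] [vxn vyn] vzn vwn]] := infinite_place_values pv vx.
exists n => //; split=> // k a b c d.
have x0 := x_neq0; have y0 := y_neq0; have t0 := t_neq0.
have [_ vt] : t != 0 /\ v t = q%:Z * v x.
  rewrite /t -(placeX pv) //; apply: (placeD pv); first exact: expf_neq0.
  by right; rewrite (placeX pv) //; have := q_gt1; nia.
rewrite /monomial !(placeM pv) ?mulf_neq0 ?expf_neq0 // !(placeX pv) // vt vxn vyn vzn vwn.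
by rewrite /weight; lia.
Qed.

Lemma reduced_neq0 f : reduced f -> f != 0.
Proof.
have [n n0 [z0 w0 _]] := infinite_place_weight.
case=> k [a [b [c [d [_ ->]]]]].
by rewrite !mulf_neq0 // expf_neq0 ?t_neq0 ?x_neq0 ?y_neq0.
Qed.

Lemma infinite_place_inj f g : reduced f -> reduced g -> v f = v g -> f = g.
Proof.
have [n n0 [_ _ vm]] := infinite_place_weight.
case=> k [a [b [c [d [B ->]]]]] [k' [a' [b' [c' [d' [B' ->]]]]]].
rewrite !vm => E; have /(weight_inj B B')[-> -> -> -> ->] // :
  weight k a b c d = weight k' a' b' c' d' by nia.
Qed.

Lemma coord_lead f : coord f -> f != 0 -> exists g e,
  [/\ reduced g, e != 0, v f = v g & vge v (v g + 1) (f - iota e * g)].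
Proof.
have [n n0 [z0 w0 vm]] := infinite_place_weight.
move=> /coord_Fspan[s [c [us rs fE]]] f0.
have [/hasP[g gs cg]|/hasPn none] := boolP (has (fun g => c g != 0) s); last first.
  case/eqP: f0; rewrite fE big1_seq // => g /andP[_ /none].
  by rewrite negbK => /eqP->; rewrite rmorph0 mul0r.
have [||g0 g0s [cg0 _ hg0]] := place_sum pv us _ _ gs cg.
- by move=> h /rs; apply: reduced_neq0.
- by move=> h1 h2 /rs r1 /rs r2; apply: infinite_place_inj.
have [_ vf] := place_sum_value pv cg0 (reduced_neq0 (rs _ g0s)) hg0.
by exists g0, (c g0); split; rewrite ?fE //; apply: rs.
Qed.

(** Distinct values prevent cancellation, so every monomial occurring in [f] has value at least
    [v f]. *)
Lemma coord_bounded f (n : int) : coord f -> vge v n f ->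
  Fspan iota (fun g => reduced g /\ n <= v g) f.
Proof.
move=> /coord_Fspan[s [c [us rs fE]]] vf.
have [/hasP[g gs cg]|/hasPn none] := boolP (has (fun g => c g != 0) s); last first.
  rewrite fE big1_seq; first exact: Fspan0.
  by move=> g /andP[_ /none]; rewrite negbK => /eqP->; rewrite rmorph0 mul0r.
have [||g0 g0s [cg0 ming0 hg0]] := place_sum pv us _ _ gs cg.
- by move=> h /rs; apply: reduced_neq0.
- by move=> h1 h2 /rs r1 /rs r2; apply: infinite_place_inj.
have [f0 vfE] := place_sum_value pv cg0 (reduced_neq0 (rs _ g0s)) hg0.
have n_le : n <= v g0 by rewrite -vfE -fE; apply: vge_neq0 vf; rewrite fE.
exists [seq g <- s | c g != 0], c; split; first exact: filter_uniq.
  move=> h; rewrite mem_filter => /andP[ch hs]; split; first exact: rs.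
  exact: le_trans (ming0 h hs ch).
rewrite fE big_filter (bigID (fun g => c g != 0)) /= [X in _ + X]big1 ?addr0 //.
by move=> h; rewrite negbK => /eqP->; rewrite rmorph0 mul0r.
Qed.

(** Leading monomials show that [n] divides all values on [R], hence on its fraction field [K]; but
    a place takes the value 1. *)
Lemma infinite_place_monomial k a b c d : v (monomial k a b c d) = - (weight k a b c d)%:Z.
Proof.
have [n n0 [_ _ vm]] := infinite_place_weight.
suff n1 : n = 1 by rewrite vm n1 mul1r.
have vcoord f : coord f -> f != 0 -> exists i : int, v f = n * i.
  move=> cf f0; have [g [e [[k' [a' [b' [c' [d' [_ ->]]]]]] _ -> _]]] := coord_lead cf f0.
  by exists (- (weight k' a' b' c' d')%:Z); rewrite vm mulrN.
have [_ _ _ [f [f0 vf]]] := pv; have [r r0 cr] := coord_frac f.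
have er0 : ev r != 0 by rewrite ev_eq0.
have [i vi] := vcoord _ (coord_ev r) er0.
have [j vj] := vcoord _ cr (mulf_neq0 er0 f0).
move: vj; rewrite (placeM pv) // vf vi => E.
have : (n %| 1)%Z by apply/dvdzP; exists (j - i); lia.
by rewrite dvdz1; lia.
Qed.

(** Write [f] as [r f] over [r] with both in [R]. As [v f = 0], the two have the same leading
    monomial, and the quotient of the leading coefficients is the residue of [f]. *)
Lemma infinite_place_rational : is_rational_place iota v.
Proof.
move=> f f0; rewrite le_eqVlt => /orP[/eqP vf|vf]; last first.
  by exists 0; rewrite rmorph0 subr0; right.
have [r r0 cr] := coord_frac f.
have er0 : ev r != 0 by rewrite ev_eq0.
have rf0 := mulf_neq0 er0 f0.
have [g [e [rg e0 vg hg]]] := coord_lead (coord_ev r) er0.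
have [g' [e' [rg' e'0 vg' hg']]] := coord_lead cr rf0.
have gg : g' = g.
  by apply: infinite_place_inj => //; rewrite -vg' -vg (placeM pv) // -vf addr0.
exists (e' / e); suff : vge v 1 (f - iota (e' / e)).
  by case=> [->|h]; [left | right; apply: lt_le_trans h].
have ie0 : iota e != 0 by rewrite fmorph_eq0.
have -> : f - iota (e' / e) =
    (ev r * f - iota e' * g - iota (e' / e) * (ev r - iota e * g)) * (ev r)^-1.
  by rewrite fmorph_div; field; rewrite ie0 er0.
have -> : 1 = (v g + 1) + v (ev r)^-1 by rewrite (placeV pv) // vg; lia.
apply: (vgeM pv); last by right.
apply: (vgeD pv); first by rewrite -gg.
apply: (vgeN pv); rewrite -[v g + 1]add0r; apply: (vgeM pv) => //.
exact: vgeC.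
Qed.

End InfinitePlace.

(** * Places at which [t] vanishes *)

Lemma prod_F u : u ^+ q + u = \prod_(c : F) (u - iota c).
Proof.
have cu : commr_rmorph iota u by move=> c; apply: mulrC.
have := congr1 (horner_morph cu) (finField_genPoly F).
rewrite hF rmorphB rmorphXn rmorph_prod /= horner_morphX oppK => ->.
by apply: eq_bigr => c _; rewrite rmorphB /= horner_morphX horner_morphC.
Qed.

Lemma iota_q c : iota c ^+ q = iota c.
Proof. by rewrite -rmorphXn /= -hF expf_card. Qed.

Lemma shift_q u c : (u - iota c) ^+ q + (u - iota c) = u ^+ q + u.
Proof. by rewrite oppK qD iota_q addrACA addKK addr0. Qed.

Lemma place_root_F (v : K -> int) u : is_place iota v -> u ^+ q + u != 0 ->
  0 < v (u ^+ q + u) -> exists2 c, u - iota c != 0 & 0 < v (u - iota c).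
Proof.
move=> pv; rewrite {1 2}prod_F => /prodf_neq0 n0 vprod.
have [//|none] := pselect (exists2 c, u - iota c != 0 & 0 < v (u - iota c)).
suff [_] : \prod_(c : F) (u - iota c) != 0 /\ v (\prod_(c : F) (u - iota c)) <= 0.
  by rewrite leNgt vprod.
elim/big_ind: _ => [|a b [a0 va] [b0 vb]|c _].
- by rewrite oner_eq0 (place1 pv).
- by rewrite mulf_neq0 // (placeM pv) //; split=> //; lia.
- split; first exact: n0.
  by rewrite leNgt; apply/negP => vc; apply: none; exists c => //; apply: n0.
Qed.

Lemma place_shift (v : K -> int) u : is_place iota v -> u != 0 -> 0 < v u ->
  v (u ^+ q + u) = v u.
Proof.
move=> pv u0 vu; rewrite addrC; apply: (placeD pv _ _).2 => //.
by right; rewrite (placeX pv) //; have := q_gt1; nia.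
Qed.

Lemma x_sub_neq0 c : x - iota c != 0.
Proof. by rewrite -evX -evC -rmorphB ev_eq0 polyXsubC_eq0. Qed.

Section FinitePlace.
Variables (v : K -> int) (pv : is_place iota v) (vx : 0 <= v x).

Lemma coord_vge0 f : coord f -> vge v 0 f.
Proof. by apply: (valring_coord (vge_valring pv)); right. Qed.

(** The localization of [R] at the center of [v], which turns out to be the whole valuation ring
    when [t] vanishes at [v]. *)
Definition local (f : K) : Prop :=
  exists a b, [/\ coord a, coord b, b != 0, v b = 0 & f = a / b].

Lemma coord_local f : coord f -> local f.
Proof.
move=> cf; exists f, 1; rewrite divr1 oner_eq0 (place1 pv); split=> //.
exact: (subalg1 coord_subalg).
Qed.

Lemma local_subalg : subalg iota local.
Proof.
split=> [c|f g|f g].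
- by apply: coord_local; apply: (subalgC coord_subalg).
- move=> [a [b [ca cb b0 vb ->]]] [a' [b' [ca' cb' b'0 vb' ->]]].
  exists (a * b' + a' * b), (b * b'); rewrite mulf_neq0 // (placeM pv) // vb vb'.
  split=> //; last by rewrite addf_div.
  + by apply: (subalgD coord_subalg); apply: (subalgM coord_subalg).
  + exact: (subalgM coord_subalg).
- move=> [a [b [ca cb b0 vb ->]]] [a' [b' [ca' cb' b'0 vb' ->]]].
  exists (a * a'), (b * b'); rewrite mulf_neq0 // (placeM pv) // vb vb'.
  by split=> //; rewrite ?mulf_div //; apply: (subalgM coord_subalg).
Qed.

Lemma local_vge0 f : local f -> vge v 0 f.
Proof.
move=> [a [b [ca cb b0 vb ->]]]; rewrite -[0]addr0; apply: (vgeM pv).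
  exact: coord_vge0.
by right; rewrite (placeV pv) // vb.
Qed.

Lemma local_inv f : local f -> f != 0 -> v f = 0 -> local f^-1.
Proof.
move=> [a [b [ca cb b0 vb ->]]]; rewrite mulf_eq0 invr_eq0 (negPf b0) orbF => a0.
rewrite (place_div pv) // vb subr0 => va.
by exists b, a; rewrite invf_div.
Qed.

Hypothesis vt : 0 < v t.

(** The factorization of [u^q + u] gives scalars [al] and [be] with [xi = x - al] and [eta = y - be]
    vanishing at [v]. As [eta] is a local multiple of [xi], the maximal ideal of the local ring is
    generated by [xi] and its residue field is [F]. So every nonzero element of [K] is a unit times
    a power of [xi], and [v t = v xi = 1]. *)
Lemma finite_place : v t = 1 /\ is_rational_place iota v.
Proof.
have t0 := t_neq0; have q1 := q_gt1.
have [al xi0 vxi] := place_root_F pv t0 vt.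
have tE : t = (x - iota al) ^+ q + (x - iota al) by rewrite shift_q.
have vyq : 0 < v (y ^+ q + y).
  by rewrite hcurve -/t (placeM pv) ?expf_neq0 ?x_neq0 // (placeX pv) ?x_neq0 //; nia.
have yq0 : y ^+ q + y != 0 by rewrite hcurve mulf_neq0 ?expf_neq0 ?x_neq0.
have [be eta0 veta] := place_root_F pv yq0 vyq.
have etaE : y ^+ q + y = (y - iota be) ^+ q + (y - iota be) by rewrite shift_q.
pose xi := x - iota al; pose eta := y - iota be.
rewrite -/xi in xi0 vxi tE; rewrite -/eta in eta0 veta etaE.
have clo f : coord f -> local f by apply: coord_local.
have cxi : coord xi.
  by apply: (subalgB coord_subalg); [exact: coord_x | exact: (subalgC coord_subalg)].
have ceta : coord eta.
  by apply: (subalgB coord_subalg); [exact: coord_y | exact: (subalgC coord_subalg)].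
have lM := subalgM local_subalg; have lD := subalgD local_subalg.
have lC := subalgC local_subalg; have lB := subalgB local_subalg.
have qS : q = q.-1.+1 by rewrite prednK // ltnW.
(* In terms of [eta] and [xi] the curve equation reads [eta (1 + eta^(q-1)) = x^q0 xi (1 +
   xi^(q-1))], where [1 + eta^(q-1)] is a unit at [v]. *)
have [gy lgy etagy] : exists2 g, local g & eta = xi * g.
  have [d0 vd] : 1 + eta ^+ q.-1 != 0 /\ v (1 + eta ^+ q.-1) = v 1.
    apply: (placeD pv); first exact: oner_neq0.
    by right; rewrite (place1 pv) (placeX pv) //; nia.
  exists ((x ^+ q0 * (1 + xi ^+ q.-1)) / (1 + eta ^+ q.-1)).
    exists (x ^+ q0 * (1 + xi ^+ q.-1)), (1 + eta ^+ q.-1).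
    rewrite d0 vd (place1 pv); split=> //.
      apply: (subalgM coord_subalg); first by apply: (subalgX coord_subalg); exact: coord_x.
      apply: (subalgD coord_subalg); first exact: (subalg1 coord_subalg).
      exact: (subalgX coord_subalg).
    apply: (subalgD coord_subalg); first exact: (subalg1 coord_subalg).
    exact: (subalgX coord_subalg).
  apply: (mulIf d0); rewrite mulrA divfK // mulrDr mulr1 -exprS -qS addrC -etaE hcurve -/t tE.
  by rewrite {1}qS exprS; ring.
have vge1 g : local g -> vge v 1 (xi * g).
  move=> lg; rewrite -[1]addr0; apply: (vgeM pv); last exact: local_vge0.
  by right; lia.
have congr_coord f : coord f -> exists c, exists2 g, local g & f = iota c + xi * g.
  move: f; apply: sub_coord; last 2 first.
  - exists al, 1; first by apply: clo; apply: (subalg1 coord_subalg).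
    by rewrite mulr1 /xi addrC subrK.
  - by exists be, gy => //; rewrite -etagy /eta addrC subrK.
  split=> [c|_ _ [c [g lg ->]] [c' [g' lg' ->]]|_ _ [c [g lg ->]] [c' [g' lg' ->]]].
  - by exists c, 0; [exact: (subalg0 local_subalg) | rewrite mulr0 addr0].
  - by exists (c + c'), (g + g'); [exact: lD | rewrite rmorphD mulrDr addrACA].
  - exists (c * c'), (iota c * g' + iota c' * g + xi * (g * g')).
      by apply: (lD); [apply: (lD)|]; apply: (lM) => //; [exact: clo | exact: lM].
    by rewrite rmorphM; ring.
have congr_local f : local f -> exists c, exists2 g, local g & f = iota c + xi * g.
  move=> [a [b [ca cb b0 vb ->]]].
  have [c [g lg aE]] := congr_coord _ ca; have [d [g' lg' bE]] := congr_coord _ cb.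
  have d0 : d != 0.
    apply/eqP => d0; rewrite d0 rmorph0 add0r in bE.
    by have := vge1 g' lg'; rewrite -bE => /(vge_neq0 b0); rewrite vb.
  have id0 : iota d != 0 by rewrite fmorph_eq0.
  have lbi : local b^-1 by apply: local_inv => //; apply: clo.
  exists (c / d), ((iota d * g - iota c * g') * iota d^-1 * b^-1).
    by apply: (lM) => //; apply: (lM) => //; apply: (lB); apply: (lM).
  rewrite fmorph_div fmorphV aE bE in b0 *; field.
  by rewrite b0.
(* Splitting off a factor [xi] lowers the value of [f], which stays nonnegative; the process ends at
   a unit. *)
have factor f : local f -> f != 0 -> exists n u,
    [/\ local u, u != 0, v u = 0 & f = xi ^+ n * u].
  have [k] := ubnP `|v f|%N; elim: k f => // k IHk f ltk lf f0.
  have vf := vge_neq0 f0 (local_vge0 lf).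
  have [c [g lg fE]] := congr_local f lf.
  have [c0|c0] := eqVneq c 0.
    rewrite c0 rmorph0 add0r in fE.
    have g0 : g != 0 by apply: contraNneq f0 => g0; rewrite fE g0 mulr0.
    have vg := vge_neq0 g0 (local_vge0 lg).
    have vfE : v f = v xi + v g by rewrite fE (placeM pv).
    have [|n [u [lu u0 vu gE]]] := IHk g _ lg g0; first by lia.
    by exists n.+1, u; split=> //; rewrite fE gE exprS mulrA.
  exists 0%N, f; split=> //; last by rewrite expr0 mul1r.
  rewrite fE -(placeC pv c0); apply: (placeD pv _ _).2; first by rewrite fmorph_eq0.
  by rewrite (placeC pv) // add0r; apply: vge1.
have factorK f : f != 0 -> exists i j u,
    [/\ local u, u != 0, v u = 0 & f * xi ^+ j = xi ^+ i * u].
  move=> f0; have [r r0 cr] := coord_frac f.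
  have er0 : ev r != 0 by rewrite ev_eq0.
  have [i [u [lu u0 vu rfE]]] := factor _ (clo _ cr) (mulf_neq0 er0 f0).
  have [j [u' [lu' u'0 vu' rE]]] := factor _ (clo _ (coord_ev r)) er0.
  exists i, j, (u / u'); split.
  - by apply: (lM) => //; apply: local_inv.
  - by rewrite mulf_neq0 ?invr_eq0.
  - by rewrite (place_div pv) // vu vu'.
  - apply: (mulIf u'0); rewrite mulrA divfK // -rfE rE; ring.
have vxi1 : v xi = 1.
  have [_ _ _ [f [f0 vf]]] := pv; have [i [j [u [_ u0 vu E]]]] := factorK f f0.
  have := congr1 v E; rewrite !(placeM pv) ?expf_neq0 // !(placeX pv) // vf vu => Ev.
  have : (v xi %| 1)%Z by apply/dvdzP; exists (i%:Z - j%:Z); lia.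
  by rewrite dvdz1; lia.
split; first by rewrite tE place_shift.
move=> f f0 vf; have [i [j [u [lu u0 vu E]]]] := factorK f f0.
have ji : (j <= i)%N.
  have := congr1 v E; rewrite !(placeM pv) ?expf_neq0 // !(placeX pv) // vxi1 vu.
  by lia.
have lf : local f.
  have -> : f = xi ^+ (i - j) * u.
    apply: (mulIf (expf_neq0 j xi0)); rewrite E mulrAC -exprD subnK //.
  by apply: (lM) => //; apply: clo; apply: (subalgX coord_subalg).
have [c [g lg ->]] := congr_local f lf.
by exists c; rewrite addrC addKr; case: (vge1 g lg) => [->|h]; [left | right; lia].
Qed.

End FinitePlace.

(** * Existence of a zero and of a pole of [x] *)

Lemma x_inv_notin_poly p : ev p != x^-1.
Proof.
apply/eqP => E; have : ev (p * 'X) = ev 1 by rewrite rmorphM rmorph1 /= evX E mulVf ?x_neq0.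
move=> /eqP; rewrite -subr_eq0 -rmorphB ev_eq0 subr_eq0 => /eqP.
move=> /(congr1 (fun r : {poly F} => size r)); rewrite size_poly1.
have [->|p0] := eqVneq p 0; first by rewrite mul0r size_poly0.
by rewrite size_mulX // => -[] /eqP; rewrite size_poly_eq0 (negPf p0).
Qed.

(** A valuation ring containing [F[x]] but not [x^-1] gives [v x > 0]. Then [v x = v t], which is 1
    by [finite_place]. *)
Lemma exists_zero_of_x : exists2 v : K -> int, is_place iota v & v x = 1.
Proof.
pose B f := exists p, f = ev p.
have algB : subalg iota B.
  split=> [c|_ _ [p ->] [r ->]|_ _ [p ->] [r ->]].
  - by exists c%:P; rewrite evC.
  - by exists (p + r); rewrite rmorphD.
  - by exists (p * r); rewrite rmorphM.
have Bx : B x by exists 'X; rewrite evX.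
have nB : ~ B x^-1 by case=> p /esym/eqP; apply/negP/x_inv_notin_poly.
have [|A [valA subA nA]] := exists_valring algB nB; first by rewrite invrK.
have [v pv vA] := place_of_curve_valring valA nA.
exists v => //; have x0 := x_neq0.
have vx : 0 < v x.
  rewrite ltNge; apply/negP => vx; apply: nA; apply/vA; first by rewrite invr_eq0.
  by rewrite (placeV pv) // oppr_ge0.
have vt : v t = v x by apply: place_shift.
by have [] := finite_place pv (ltW vx); rewrite vt.
Qed.

Lemma exists_pole_of_x : exists2 v : K -> int, is_place iota v & v x < 0.
Proof.
have x0 := x_neq0.
(* This is [F[x^-1]], written as fractions [p / x^n] with [p] of degree at most [n]. *)
pose B f := exists n (p : {poly F}), (size p <= n.+1)%N /\ f = ev p / x ^+ n.
have algB : subalg iota B.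
  split=> [c|_ _ [n [p [sp ->]]] [k [r [sr ->]]]|_ _ [n [p [sp ->]]] [k [r [sr ->]]]].
  - by exists 0%N, c%:P; rewrite size_polyC_leq1 evC expr0 divr1.
  - exists (n + k)%N, (p * 'X^k + r * 'X^n); split.
      apply: leq_trans (size_polyD _ _) _; rewrite geq_max.
      by apply/andP; split; apply: leq_trans (size_polyMleq _ _) _; rewrite size_polyXn; lia.
    rewrite rmorphD !rmorphM !rmorphXn /= evX exprD; field.
    by rewrite !expf_neq0.
  - exists (n + k)%N, (p * r); split.
      by apply: leq_trans (size_polyMleq _ _) _; lia.
    by rewrite rmorphM exprD /= mulf_div.
have Bx : B x^-1.
  by exists 1%N, 1; rewrite size_poly1 rmorph1 mul1r.
have nB : ~ B x.
  case=> n [p [sp E]]; have /eqP : x ^+ n.+1 = ev p.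
    by rewrite exprS {1}E divfK ?expf_neq0.
  rewrite -evX -rmorphXn -subr_eq0 -rmorphB ev_eq0 subr_eq0 => /eqP pE.
  by move: sp; rewrite -pE size_polyXn ltnn.
have [A [valA subA nA]] := exists_valring algB nB Bx.
have [v pv vA] := place_of_curve_valring valA nA.
by exists v => //; rewrite ltNge; apply/negP => /(vA _ x0).
Qed.

(** * Integral closedness of [F[x,y]] *)

Lemma x_nonsquare g : g ^+ 2 != x.
Proof.
have [v pv vx] := exists_zero_of_x; apply/eqP => gx.
have g0 : g != 0 by apply: contraTneq x_neq0 => g0; rewrite -gx g0 expr0n eqxx.
by have := placeX pv 2 g0; rewrite gx vx; lia.
Qed.

Lemma sqrD (R : comNzRingType) (a b : R) : 2 \in [pchar R] ->
  (a + b) ^+ 2 = a ^+ 2 + b ^+ 2.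
Proof. by move=> ch; rewrite sqrrD -mulr_natr pcharf0 // mulr0 addr0. Qed.

(** Squaring is additive, so two different decompositions would make [x] the square of
    [(a + c) / (b + d)]. *)
Lemma sqr_decomp_inj a b c d :
  a ^+ 2 + x * b ^+ 2 = c ^+ 2 + x * d ^+ 2 -> a = c /\ b = d.
Proof.
move=> E; have {}E : (a + c) ^+ 2 = x * (b + d) ^+ 2.
  rewrite !(sqrD _ _ charK) mulrDr; apply/eqP; rewrite -subr_eq0 oppK.
  by rewrite addrACA E addKK.
have [bd|bd] := eqVneq (b + d) 0.
  have /eqP := E; rewrite bd expr0n mulr0 expf_eq0 /= => ac.
  by split; apply/eqP; rewrite -subr_eq0 oppK // bd.
case/negP: (x_nonsquare ((a + c) / (b + d))).
by rewrite expr_div_n E mulfK // expf_neq0.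
Qed.

Lemma scalar_sqrt (c : F) : exists e, e ^+ 2 = c.
Proof.
exists (c ^+ (q0 ^ 2)); rewrite -exprM mulnC -q_double -hF; exact: expf_card.
Qed.

(* The curve equation gives [y = y^q + x^(q0+q) + x * x^q0], so that [y] too
   is of the form [a^2 + x b^2]. *)
Lemma coord_sqr_decomp f : coord f ->
  exists a b, [/\ coord a, coord b & f = a ^+ 2 + x * b ^+ 2].
Proof.
have cX n u : coord u -> coord (u ^+ n) by apply: (subalgX coord_subalg).
have cD := subalgD coord_subalg; have cM := subalgM coord_subalg.
have c0 := subalg0 coord_subalg; have c1 := subalg1 coord_subalg.
move: f; apply: sub_coord.
- split=> [c|_ _ [a [b [ca cb ->]]] [a' [b' [ca' cb' ->]]]
            |_ _ [a [b [ca cb ->]]] [a' [b' [ca' cb' ->]]]].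
  + have [e <-] := scalar_sqrt c; exists (iota e), 0; split=> //.
      exact: (subalgC coord_subalg).
    by rewrite expr0n mulr0 addr0 rmorphXn.
  + exists (a + a'), (b + b'); split; [exact: cD | exact: cD |].
    by rewrite !(sqrD _ _ charK) mulrDr addrACA.
  + exists (a * a' + x * (b * b')), (a * b' + b * a'); split.
    * by apply: (cD); [apply: (cM) | apply: (cM); [exact: coord_x | apply: (cM)]].
    * by apply: (cD); apply: (cM).
    * by rewrite !(sqrD _ _ charK) !exprMn; ring.
- by exists 0, 1; split=> //; rewrite expr0n add0r expr1n mulr1.
- have q0E : q0 = (2 * (2 ^ m.-1))%N by rewrite hq0 -expnS prednK.
  (* The exponents are halves: [2^(m-1)] of [q0], and [q0^2] of [q]. *)
  exists (y ^+ (q0 ^ 2) + x ^+ (2 ^ m.-1 + q0 ^ 2)), (x ^+ (2 ^ m.-1)).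
  have [cx cy] := (coord_x, coord_y).
  split; [by apply: (cD); apply: cX | exact: cX |].
  rewrite (sqrD _ _ charK) -!exprM mulnDl ![(_ * 2)%N]mulnC -q0E -q_double.
  rewrite y_q /t exprD; set X := x ^+ q0; set Q := x ^+ q.
  rewrite -[LHS]addr0 -(addKK (X * Q)) -[LHS]addr0 -(addKK (X * x)); ring.
Qed.

(** This is the splitting into even and odd parts, with square roots of the coefficients. A Horner
    step [r * 'X + c] exchanges the roles of [r0] and [r1]. *)
Lemma poly_sqr_decomp (r : {poly F}) : exists r0 r1 : {poly F},
  [/\ r = r0 ^+ 2 + 'X * r1 ^+ 2, (2 * size r0 <= (size r).+1)%N
    & (2 * size r1 <= size r)%N].
Proof.
have chP : 2 \in [pchar {poly F}] by apply: (rmorph_pchar polyC charF).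
elim/poly_ind: r => [|r c [r0 [r1 [rE s0 s1]]]].
  by exists 0, 0; rewrite expr0n mulr0 addr0 size_poly0.
have [e ec] := scalar_sqrt c.
exists (r1 * 'X + e%:P), r0; split.
- by rewrite (sqrD _ _ chP) -polyC_exp ec {1}rE; ring.
- rewrite !size_MXaddC; case: ifP => // /negP n0; case: ifP; last by lia.
  move=> /andP[/eqP r_0 /eqP c_0]; case: n0; move: s1; rewrite r_0 size_poly0 => s1.
  have e0 : e == 0 by have := expf_eq0 e 2; rewrite ec c_0 eqxx.
  by rewrite e0 andbT -size_poly_eq0; lia.
- rewrite size_MXaddC; case: ifP; last by lia.
  by move=> /andP[/eqP r_0 _]; move: s0; rewrite r_0 size_poly0; lia.
Qed.

(* By uniqueness of the decomposition [a^2 + x b^2], a common denominator [r]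
   of all powers of [h] may be replaced by its square-root components [r0] and
   [r1], of smaller degree. *)
Lemma almost_integral_coord h (r : {poly F}) : r != 0 ->
  (forall n, coord (ev r * h ^+ n)) -> coord h.
Proof.
have [k] := ubnP (size r); elim: k r => // k IHk r ltk r_0 cr.
have [r0 [r1 [rE s0 s1]]] := poly_sqr_decomp r.
have evr : ev r = ev r0 ^+ 2 + x * ev r1 ^+ 2.
  by rewrite rE rmorphD rmorphXn [ev ('X * _)]rmorphM rmorphXn evX.
have both n : coord (ev r0 * h ^+ n) /\ coord (ev r1 * h ^+ n).
  have [a [b [ca cb]]] := coord_sqr_decomp (cr (n * 2)%N).
  rewrite evr exprM mulrDl -mulrA -!exprMn.
  by move=> /sqr_decomp_inj[-> ->].
have szr : (0 < size r)%N by rewrite size_poly_gt0.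
(* For constant [r] the component [r0] need not have smaller degree, so this case is settled by
   dividing by the constant. *)
have [sz1|sz1] := leqP (size r) 1.
  have rC := size1_polyC sz1; have c0 : r`_0 != 0 by apply: contraNneq r_0 => c0; rewrite rC c0.
  have ic0 : iota r`_0 != 0 by rewrite fmorph_eq0.
  rewrite -(mulKf ic0 h) -fmorphV; apply: (subalgM coord_subalg).
    exact: (subalgC coord_subalg).
  by have := cr 1%N; rewrite expr1 rC evC coefC eqxx.
have [r00|r00] := eqVneq r0 0.
  have r10 : r1 != 0 by apply: contraNneq r_0 => r10; rewrite rE r00 r10 expr0n mulr0 addr0.
  apply: (IHk r1) => // [|n]; last by case: (both n).
  by move: (size r) (size r1) s1 ltk szr; lia.
apply: (IHk r0) => // [|n]; last by case: (both n).
by move: (size r) (size r0) s0 ltk sz1; lia.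
Qed.

(** If [h] is not in [R[h^-1]], some valuation ring contains [R[h^-1]] and avoids [h]; its place has
    [v x >= 0] and [v h < 0]. Otherwise [h] is integral over [R], so its powers have a common
    denominator and [almost_integral_coord] applies. *)
Lemma coord_of_places h :
  (forall v : K -> int, is_place iota v -> 0 <= v x -> vge v 0 h) -> coord h.
Proof.
move=> hv; have [//|nch] := pselect (coord h).
have h0 : h != 0 by apply/eqP => h0; case: nch; rewrite h0; apply: (subalg0 coord_subalg).
have [[p cp hp]|nadj] := pselect (adjoin coord h^-1 h); last first.
  have [|A [valA subA nA]] := exists_valring (adjoin_subalg coord_subalg h^-1) nadj.
    exact: mem_adjoin coord_subalg _.
  have [v pv vA] := place_of_curve_valring valA nA.
  case: nA; apply/(vA _ h0); apply: vge_neq0 => //; apply: hv => //.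
  apply/(vA _ x_neq0); apply: subA; apply: (sub_adjoin coord_subalg); exact: coord_x.
set d := size p.
have d_gt0 : (0 < d)%N.
  rewrite size_poly_gt0; apply: contraNneq h0 => p0.
  by rewrite hp p0 horner0.
have hd n : (d <= n)%N -> h ^+ n = \sum_(i < d) p`_i * h ^+ (n.-1 - i).
  move=> dn; have n0 : (0 < n)%N by apply: leq_trans dn.
  rewrite -{1}(prednK n0) exprSr {2}hp horner_coef mulr_sumr; apply: eq_bigr => i _.
  rewrite mulrCA; congr (_ * _); rewrite exprVn.
  apply: (mulIf (expf_neq0 i h0)); rewrite divfK ?expf_neq0 // -exprD subnK //.
  by rewrite -ltnS prednK // (leq_trans (ltn_ord i)).
have [r r0 cr] := coord_frac h.
(* With [r h] in [R], the factor [r^d] clears [h^n] for [n < d]; higher powers reduce to these by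
   [hd]. *)
apply: (@almost_integral_coord h (r ^+ d)); first exact: expf_neq0.
elim/ltn_ind => n IHn; rewrite rmorphXn /=.
have [dn|nd] := leqP d n.
  rewrite hd // mulr_sumr; apply: (subalg_sum coord_subalg) => i _.
  rewrite mulrCA; apply: (subalgM coord_subalg) => //; rewrite -rmorphXn; apply: IHn.
  by rewrite (leq_ltn_trans (leq_subr _ _)) // prednK // (leq_trans d_gt0).
rewrite -(subnK (ltnW nd)) exprD -mulrA -exprMn; apply: (subalgM coord_subalg).
  by apply: (subalgX coord_subalg); apply: coord_ev.
exact: (subalgX coord_subalg).
Qed.

(** * The basis of [L(lD)] *)

Section RiemannRochBasis.
Variables (l : nat) (hl : (l <= q ^ 2 - 1)%N).

Definition basis_elt (f : K) : Prop := exists a b c d r : nat,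
  [/\ (a * q + b * (q + q0) + c * (q + 2 * q0) + d * (q + 2 * q0 + 1)
         <= r * q ^ 2 + l)%N,
      [/\ (a <= q - 1)%N, (b <= 1)%N, (c <= q0 - 1)%N, (d <= q0 - 1)%N
          & (r <= l)%N] &
      f = x ^+ a * y ^+ b * z ^+ c * w ^+ d / t ^+ r].

(** Multiplication by [t^l] turns [t^-r] into [t^k] with [k = l - r], and the bound on the pole
    order becomes one on the weight that no longer involves [r]. *)
Lemma basis_eltP f : basis_elt f <-> exists k a b c d : nat,
  [/\ [/\ (a < q)%N, (b < 2)%N, (c < q0)%N & (d < q0)%N],
      (k <= l)%N, (weight k a b c d <= l * q ^ 2 + l)%N
    & f * t ^+ l = monomial k a b c d].
Proof.
have q02 := q0_gt1; have q1 := q_gt1; have t0 := t_neq0.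
split=> [[a [b [c [d [r [wt [ha hb hc hd hr] ->]]]]]]|[k [a [b [c [d [[ha hb hc hd] hk wt E]]]]]]].
  exists (l - r)%N, a, b, c, d; split; [by split; lia | by rewrite leq_subr | |].
    have -> : (l * q ^ 2 = (l - r) * q ^ 2 + r * q ^ 2)%N by rewrite -mulnDl subnK.
    by rewrite /weight -[X in (_ <= X)%N]addnA leq_add2l.
  have -> : t ^+ l = t ^+ (l - r) * t ^+ r by rewrite -exprD subnK.
  by rewrite /monomial; field; rewrite expf_neq0.
exists a, b, c, d, (l - k)%N; split; [| by split; lia |].
  move: wt; have -> : (l * q ^ 2 = k * q ^ 2 + (l - k) * q ^ 2)%N by rewrite -mulnDl subnKC.
  by rewrite /weight -[X in (_ <= X)%N]addnA leq_add2l.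
apply: (mulIf (expf_neq0 l t0)); rewrite E /monomial.
have -> : t ^+ l = t ^+ k * t ^+ (l - k) by rewrite -exprD subnKC.
by field; rewrite expf_neq0.
Qed.

Lemma basis_elt_neq0 f : basis_elt f -> f != 0.
Proof.
have [v pv vx] := exists_pole_of_x.
move=> /basis_eltP[k [a [b [c [d [B _ _ E]]]]]].
have : f * t ^+ l != 0 by rewrite E; apply: (reduced_neq0 pv vx); exists k, a, b, c, d.
by rewrite mulf_eq0 => /norP[].
Qed.

Lemma t_pole_value (v : K -> int) : is_place iota v -> v x < 0 -> v t = - (q ^ 2)%:Z.
Proof.
move=> pv vx; have := infinite_place_monomial pv vx 1 0 0 0 0.
by rewrite /monomial /weight !expr0 !mulr1 expr1 => ->; rewrite mul1n !mul0n !addn0.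
Qed.

(** At a pole of [x] the weight bound is exactly what is needed, since [v t = -q^2]. Elsewhere the
    numerator is regular and [t^r] has value 0, or else value [r <= l] at a rational place. *)
Lemma basis_elt_RR f : basis_elt f -> RR_lD iota l f.
Proof.
move=> Bf; have fn0 := basis_elt_neq0 Bf; have t0 := t_neq0.
move=> v pv f0; have vM := placeM pv.
have [vx|vx] := ltP (v x) 0.
  split; last by case; apply: infinite_place_rational.
  move=> _; have [k [a [b [c [d [B _ wt /(congr1 v)]]]]]] := (basis_eltP f).1 Bf.
  rewrite (infinite_place_monomial pv vx) vM ?expf_neq0 // (placeX pv) //.
  by rewrite t_pole_value //; move: (q ^ 2)%N wt => Q; lia.
have [a [b [c [d [r [_ [_ _ _ _ hr] fE]]]]]] := Bf.
have ct : coord t by rewrite -evt; apply: coord_ev.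
have vf : - (r%:Z * v t) <= v f.
  have : vge v (0 - r%:Z * v t) f.
    rewrite fE; apply: (vgeM pv); last first.
      by right; rewrite (placeV pv) ?expf_neq0 // (placeX pv).
    apply: (coord_vge0 pv vx).
    by do ![apply: (subalgM coord_subalg)]; apply: (subalgX coord_subalg);
      [exact: coord_x | exact: coord_y | exact: coord_z | exact: coord_w].
  by rewrite sub0r => /(vge_neq0 f0).
have := vge_neq0 t0 (coord_vge0 pv vx ct); rewrite le_eqVlt => /orP[/eqP vt|vt].
  by move: vf; rewrite -vt mulr0 oppr0 => vf; split=> // _; lia.
have [vt1 rat] := finite_place pv vx vt.
by move: vf; rewrite vt1 => vf; split=> // _; lia.
Qed.

(** At a pole of [x], multiplication by [t^l] shifts all values equally, so the basis elements
    inherit distinct values from the reduced monomials. *)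
Lemma basis_elt_lin_indep : lin_indep iota basis_elt.
Proof.
have [v pv vx] := exists_pole_of_x; have t0 := t_neq0.
move=> s c us Bs sum0 f fs; apply/eqP; apply: contraT => cf.
have red g : g \in s -> reduced (g * t ^+ l).
  by move=> /Bs /basis_eltP[k [a [b [e [d [B _ _ E]]]]]]; exists k, a, b, e, d.
have [||g gs [cg _ hg]] := place_sum pv us _ _ fs cf.
- by move=> g /Bs; apply: basis_elt_neq0.
- move=> g h gs hs vgh; apply: (mulIf (expf_neq0 l t0)).
  apply: (infinite_place_inj pv vx); [exact: red | exact: red |].
  by rewrite !(placeM pv) ?expf_neq0 ?vgh //; apply: basis_elt_neq0; apply: Bs.
have [] := place_sum_value pv cg (basis_elt_neq0 (Bs _ gs)) hg.
by rewrite sum0 eqxx.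
Qed.

Lemma RR_basis_elt_Fspan f : RR_lD iota l f -> Fspan iota basis_elt f.
Proof.
move=> Lf; have t0 := t_neq0; have tl0 : t ^+ l != 0 by rewrite expf_neq0.
have [->|f0] := eqVneq f 0; first exact: Fspan0.
have cftl : coord (f * t ^+ l).
  apply: coord_of_places => v pv vx.
  have ct : coord t by rewrite -evt; apply: coord_ev.
  have vt := vge_neq0 t0 (coord_vge0 pv vx ct).
  have [Lr Ln] := Lf v pv f0; right; rewrite (placeM pv) // (placeX pv) //.
  have [rat|nrat] := pselect (is_rational_place iota v); last first.
    by have := Ln nrat; nia.
  (* At a rational place [x] is congruent to a scalar [c], whence [v t = v (x - c) >= 1] and [t^l]
     absorbs the pole of [f]. *)
  have [c [xc|vxc]] := rat x x_neq0 vx.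
    by have := x_sub_neq0 c; rewrite xc eqxx.
  have := place_shift pv (x_sub_neq0 c) vxc; rewrite shift_q -/t => vtE.
  by have := Lr rat; nia.
have [v pv vx] := exists_pole_of_x.
have vf : - l%:Z <= v f.
  have [Lr Ln] := Lf v pv f0.
  by apply: Lr; apply: infinite_place_rational.
have vftl : vge v (- (l * q ^ 2 + l)%:Z) (f * t ^+ l).
  right; rewrite (placeM pv) // (placeX pv) // t_pole_value //.
  by move: (q ^ 2)%N => Q; nia.
rewrite -(mulfK tl0 f); apply: (Fspan_mulr _ (coord_bounded pv vx cftl vftl)).
move=> g [[k [a [b [c [d [B ->]]]]]]]; rewrite (infinite_place_monomial pv vx) => wt.
apply/basis_eltP; exists k, a, b, c, d; split=> //; last by rewrite divfK.
  (* If [k > l], the weight would be at least [(l + 1) q^2], which exceeds [l q^2 + l] because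
     [l < q^2]. *)
  have := q_gt1; move: wt; rewrite /weight; set N := (_ + d * _)%N.
  rewrite leNgt => wt q1; rewrite leqNgt; apply/negP => lk; case/negP: wt.
  by have : (0 < q ^ 2)%N by [rewrite expn_gt0 ltnW]; move: (q ^ 2)%N hl N => Q hQ N; nia.
by move: wt; rewrite lerN2.
Qed.

Lemma RR_basis : is_basis_of iota basis_elt (RR_lD iota l).
Proof.
split; [exact: basis_elt_RR | exact: basis_elt_lin_indep |].
by move=> f /RR_basis_elt_Fspan[s [c [_ Bs ->]]]; exists s, c.
Qed.

End RiemannRochBasis.

End SuzukiCurve.

Unset Implicit Arguments.

Theorem theorem3p1 (m q0 q : nat) (hm : (1 <= m)%N)
  (hq0 : q0 = (2 ^ m)%N) (hq : q = (2 ^ (2 * m + 1))%N)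
  (F : finFieldType) (hF : #|F| = q)
  (K : fieldType) (iota : {rmorphism F -> K}) (x y : K)
  (hcurve : y ^+ q + y = x ^+ q0 * (x ^+ q + x))
  (htrans : forall p : {poly F}, (map_poly iota p).[x] = 0 -> p = 0)
  (hgen : forall f : K, exists p r : {poly {poly F}},
      ev2 iota x y r != 0 /\ f = ev2 iota x y p / ev2 iota x y r)
  (l : nat) (hl : (l <= q ^ 2 - 1)%N) :
  let z := x ^+ (2 * q0 + 1) - y ^+ (2 * q0) in
  let w := x * y ^+ (2 * q0) - z ^+ (2 * q0) in
  is_basis_of iota
    (fun f : K => exists a b c d r : nat,
        [/\ (a * q + b * (q + q0) + c * (q + 2 * q0) + d * (q + 2 * q0 + 1)
               <= r * q ^ 2 + l)%N,
            [/\ (a <= q - 1)%N, (b <= 1)%N, (c <= q0 - 1)%N, (d <= q0 - 1)%N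
                & (r <= l)%N] &
            f = x ^+ a * y ^+ b * z ^+ c * w ^+ d / (x ^+ q + x) ^+ r])
    (RR_lD iota l).
Proof. by move=> z w; apply: (RR_basis hm hq0 hq hF). Qed.
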